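(* For every real $d$ with $0\le d\le\tfrac12$, the fifth cumulant $\kappa_5(d)$ of the Rosenblatt distribution with parameter $d$ is $$\kappa_5(d)=3840\left(\tfrac12(1-2d)(1-d)\right)^{5/2}\frac{\Gamma(4-5d)}{\Gamma(6-5d)}\,S,$$ where $$\begin{aligned} S={}&\frac{\Gamma(1-d)^4}{\Gamma(4-4d)} +\frac{\Gamma(1-d)^3}{(1-d)\,\Gamma(2-2d)}\,\frac{\Gamma(3-3d)}{\Gamma(4-4d)}\;{}_3F_2\!\left(d,\,1-d,\,3-3d;\;2-d,\,4-4d;\;1\right)\\ &+\frac{\Gamma(1-d)^2\,\Gamma(2-2d)}{(1-d)\,\Gamma(4-4d)}\;{}_3F_2\!\left(d,\,1-d,\,2-2d;\;2-d,\,4-4d;\;1\right)\\ &+\frac{\Gamma(1-d)^2}{3(1-d)\,\Gamma(3-2d)}\;{}_3F_2\!\left(1,\,d,\,3-3d;\;3-2d,\,4-3d;\;1\right)\\ &+\frac{2\,\Gamma(1-d)^2}{3(1-d)^2\,\Gamma(2-2d)}\;{}_3F_2\!\left(1,\,d,\,3-3d;\;2-d,\,4-3d;\;1\right)\\ &+\frac{\Gamma(1-d)^2}{(1-d)\,\Gamma(3-2d)}\;{}_3F_2\!\left(1,\,d,\,2-2d;\;2-d,\,3-2d;\;1\right). \end{aligned}$$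
   Context: For $0\le d\le\tfrac12$ and an integer $k\ge 2$ put $$c_k=c_k(d)=\int_0^1\!\int_0^1\!\cdots\!\int_0^1 |x_1-x_2|^{-d}|x_2-x_3|^{-d}\cdots|x_{k-1}-x_k|^{-d}|x_k-x_1|^{-d}\,dx_1\,dx_2\cdots dx_k ,$$ and $\sigma(d)=\left(\tfrac12(1-2d)(1-d)\right)^{1/2}$. The Rosenblatt distribution with parameter $d$ has characteristic function given, for $\theta$ near the origin, by $$\varphi(\theta)=\exp\left(\frac12\sum_{k=2}^\infty\big(2i\theta\,\sigma(d)\big)^k\frac{c_k}{k}\right),$$ and its $k$-th cumulant, for $k\ge2$, is given by $$\kappa_k(d)=2^{k-1}(k-1)!\,\big(\sigma(d)\big)^k c_k .$$ In particular $\kappa_5(d)=384\left(\tfrac12(1-2d)(1-d)\right)^{5/2}c_5(d)$, where $$c_5(d)=\int_{[0,1]^5}|x_1-x_2|^{-d}|x_2-x_3|^{-d}|x_3-x_4|^{-d}|x_4-x_5|^{-d}|x_5-x_1|^{-d}\,dx_1dx_2dx_3dx_4dx_5 .$$ Here $\Gamma$ is the Gamma function, $(a)_n=a(a+1)\cdots(a+n-1)$ with $(a)_0=1$ is the Pochhammer symbol, and ${}_3F_2(a,b,c;e,f;z)=\sum_{n=0}^\infty \frac{(a)_n(b)_n(c)_n}{(e)_n(f)_n}\frac{z^n}{n!}$ is the generalized hypergeometric function. *)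

(* Defs.v *)
From HB Require Import structures.
From mathcomp Require Import all_boot all_order all_algebra.
From mathcomp Require Import all_classical all_reals all_analysis.

Set Implicit Arguments.
Unset Strict Implicit.
Unset Printing Implicit Defensive.

Import Order.TTheory GRing.Theory Num.Theory.
Import numFieldNormedType.Exports.

Local Open Scope classical_set_scope.
Local Open Scope ring_scope.

(* Euler's integral: it is the Gamma function only for x > 0. *)
Definition Gamma (R : realType) (x : R) : R :=
  \int[@lebesgue_measure R]_(t in `]0%R, +oo[) (t `^ (x - 1) * expR (- t)).

Definition pochhammer (R : realType) (a : R) (n : nat) : R :=
  \prod_(i < n) (a + i%:R).

(* Total: junk value where the series diverges or e, f are poles. *)
Definition hyper3F2 (R : realType) (a b c e f z : R) : R :=
  limn (series (fun n : nat =>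
    pochhammer a n * pochhammer b n * pochhammer c n
      / (pochhammer e n * pochhammer f n) * (z ^+ n / n`!%:R))).

(* Iterated Lebesgue integral over [0, 1]^n, first coordinate outermost. *)
Fixpoint cube_integral (R : realType) (n : nat) :
    (n.-tuple R -> \bar R) -> \bar R :=
  match n with
  | 0 => fun F => F [tuple]
  | m.+1 => fun F =>
      (\int[@lebesgue_measure R]_(x in `[0%R, 1%R])
         cube_integral (fun s : m.-tuple R => F [tuple of x :: s]))%E
  end.

(* ordS is the cyclic successor on 'I_k, so the last factor is
   |x_k - x_1|^(-d).  The convention 0 `^ (- d) = 0 for d <> 0 only matters on
   a null set.  The value is in \bar R because c_2(1/2) = +oo. *)
Definition cyclic_integral (R : realType) (d : R) (k : nat) : \bar R :=
  cube_integral (fun x : k.-tuple R =>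
    (\prod_(i < k) `|tnth x i - tnth x (ordS i)| `^ (- d))%:E).

Definition rosenblatt_sigma (R : realType) (d : R) : R :=
  (2^-1 * (1 - 2 * d) * (1 - d)) `^ 2^-1.

(* k-th cumulant, k >= 2, of the Rosenblatt distribution with parameter d,
   i.e. k! times the coefficient of (i theta)^k in the logarithm
     1/2 sum_(k >= 2) (2 i theta sigma(d))^k c_k / k
   of its characteristic function. *)
Definition rosenblatt_cumulant (R : realType) (d : R) (k : nat) : \bar R :=
  ((2 ^+ k.-1 * (k.-1)`!%:R * rosenblatt_sigma d ^+ k)%:E
     * cyclic_integral d k)%E.

(* Main.v *)
Require Import Defs.
From mathcomp Require Import all_boot all_order all_algebra.
From mathcomp Require Import all_classical all_reals all_analysis.
From mathcomp Require Import measurable_realfun ring lra.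

(** A cyclic product of five kernels [|x - y|^(-d)] is a closed chain. Splitting
a chain at its largest point, and using that the kernel is invariant under
translation and reflection and homogeneous of degree [-d], reduces [c_5] first
to closed chains based at an endpoint of [[0, 1]], and then to chains from [0]
to [1] inside [[0, 1]]:
[c_5 = 2 / ((1 - d) (4 - 5 d)) (C_3 + C_1 C_2)], where [C_n] is the integral over
chains from [0] to [1] with [n] intermediate points and [C_0 = 1]. Everything is
nonnegative, so all of this is Tonelli's theorem in the extended reals.

With [B = C_1 = Beta(1 - d, 1 - d)] and
[T_s(v) = \int_0^v (v - w)^(s - 1) (1 - w)^(-d) dw], cutting [[0, 1]] at an
intermediate point expresses [C_2] and [C_3] by Beta integrals and
[\int_0^1 v^(p - 1) T_s(v) dv]. The latter is a 3F2 at 1: expand [(1 - w)^(-d)]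
by the binomial series and integrate termwise. In the sum [S], the first term is
[B^2 Beta(2 - 2 d, 2 - 2 d)], the fourth, fifth and sixth are the integrals of
[T_s], and the second and third add up to [B^2 Beta(1 - d, 2 - 2 d)]: by the
binomial series they are [B \int_0^1 t^(a - 1) (1 - t)^(b - 1) I(t) dt] for
[(a, b) = (2 - 2 d, 1 - d)] and [(1 - d, 2 - 2 d)], where [I] is the incomplete
Beta integral, and [I(t) + I(1 - t) = B]. *)

Set Implicit Arguments.
Unset Strict Implicit.
Unset Printing Implicit Defensive.

Import Order.TTheory GRing.Theory Num.Theory.
Import numFieldNormedType.Exports.

Local Open Scope classical_set_scope.
Local Open Scope ring_scope.

(** * Tonelli and affine substitutions *)

Section tonelli.
Local Open Scope ereal_scope.
Context (R : realType).
Local Notation mu := (@lebesgue_measure R).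

Lemma emeasurable_fun_restrict_bool d (T : measurableType d) (P : T -> bool)
    (f : T -> \bar R) :
  measurable_fun setT P -> measurable_fun setT f ->
  measurable_fun setT (fun t => if P t then f t else 0).
Proof. by move=> mP mf; apply: measurable_fun_ifT. Qed.

(** The domain moves with the parameter. Extending the integrand by zero makes it fixed, and the
    measurability half of Tonelli's theorem applies. *)
Lemma emeasurable_fun_integral d (T : measurableType d) (P : T -> R -> bool)
    (f : T -> R -> \bar R) :
  measurable_fun setT (fun p : T * R => P p.1 p.2) ->
  measurable_fun setT (fun p : T * R => f p.1 p.2) ->
  (forall t x, 0 <= f t x) ->
  measurable_fun setT (fun t => \int[mu]_(x in [set x | P t x]) f t x).
Proof.
move=> mP mf f0.
pose g (p : T * measurableTypeR R) : \bar R := if P p.1 p.2 then f p.1 p.2 else 0.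
have mg : measurable_fun setT g by exact: emeasurable_fun_restrict_bool.
have g0 p : 0 <= g p by rewrite /g; case: ifP.
have := @measurable_fun_fubini_tonelli_F _ _ _ _ _ mu g mg g0.
congr (measurable_fun setT _); apply/funext => t.
rewrite [RHS]integral_mkcond; apply: eq_integral => x _ /=.
by rewrite /patch mem_setE.
Qed.

Lemma tonelli_rel (P : R -> R -> bool) (f : R -> R -> \bar R) :
  measurable_fun setT (fun p : R * R => P p.1 p.2) ->
  measurable_fun setT (fun p : R * R => f p.1 p.2) ->
  (forall t x, 0 <= f t x) ->
  \int[mu]_x \int[mu]_(y in [set y | P x y]) f x y =
  \int[mu]_y \int[mu]_(x in [set x | P x y]) f x y.
Proof.
move=> mP mf f0.
pose g (p : measurableTypeR R * measurableTypeR R) : \bar R := if P p.1 p.2 then f p.1 p.2 else 0.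
have mg : measurable_fun setT g by exact: emeasurable_fun_restrict_bool.
have g0 p : 0 <= g p by rewrite /g; case: ifP.
transitivity (\int[mu]_x \int[mu]_y g (x, y)).
  apply: eq_integral => x _; rewrite integral_mkcond; apply: eq_integral => y _.
  by rewrite /patch mem_setE.
rewrite (@fubini_tonelli _ _ _ _ _ mu mu g mg g0); apply: eq_integral => y _.
rewrite [RHS]integral_mkcond; apply: eq_integral => x _.
by rewrite /patch mem_setE.
Qed.

End tonelli.

Section affine.
Local Open Scope ereal_scope.
Context (R : realType).
Local Notation mu := (@lebesgue_measure R).

Lemma affine_measurable (a b : R) : measurable_fun setT (fun x : R => (a * x + b)%R).
Proof. by apply: measurable_funD => //; apply: measurable_funM. Qed.

(** As functions of [A] both sides are measures, and they agree on half-open intervals; uniqueness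
    of Lebesgue measure does the rest. *)
Lemma lebesgue_measure_affine (a b : R) (A : set R) : (0 < a)%R ->
  measurable A -> a%:E * mu ((fun x => (a * x + b)%R) @^-1` A) = mu A.
Proof.
move=> a0 mA.
have maff : measurable_fun setT (fun x => a * x + b : measurableTypeR R)%R.
  exact: affine_measurable.
pose nu := measure_function_pushforward__canonical__measure_function_Measure mu maff.
suff -> : mu A = mscale (NngNum (ltW a0)) nu A by [].
apply: (lebesgue_measure_unique (mu := mscale (NngNum (ltW a0)) nu)) => //= _ [[l r]] _ <-.
rewrite /mscale /= /pushforward.
rewrite (_ : _ @^-1` _ = `]((l - b) / a)%R, ((r - b) / a)%R]%classic); last first.
  apply/seteqP; split=> x /=; rewrite !in_itv /= ltr_pdivrMr// ler_pdivlMr//;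
    rewrite ltrBlDr lerBrDr; by rewrite mulrC.
rewrite !lebesgue_measure_itv/= !lte_fin ltr_pM2r ?invr_gt0// ltrD2r.
case: ifPn => _; last by rewrite mule0.
by rewrite -EFinM -EFinB; congr EFin; field; rewrite gt_eqF.
Qed.

Lemma ge0_integral_affine (a b : R) (f : R -> \bar R) : (0 < a)%R ->
  measurable_fun setT f -> (forall x, 0 <= f x) ->
  \int[mu]_x f x = a%:E * \int[mu]_x f (a * x + b)%R.
Proof.
move=> a0 mf f0.
pose phi (x : measurableTypeR R) : measurableTypeR R := (a * x + b)%R.
have mphi : measurable_fun setT phi by exact: affine_measurable.
have mf' : measurable_fun (setT : set (measurableTypeR R)) f by [].
have f0' : {in [set: measurableTypeR R], forall y, 0 <= f y} by [].
have := @ge0_integral_pushforward _ _ _ _ _ phi mphi mu setT f measurableT mf' f0'.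
rewrite preimage_setT /phi /= => <-.
rewrite -(@ge0_integral_mscale _ _ _ _ _ _ (NngNum (ltW a0)))//.
by apply: eq_measure_integral => A mA _; rewrite -[LHS](@lebesgue_measure_affine a b).
Qed.

Lemma ge0_integral_opp (f : R -> \bar R) :
  measurable_fun setT f -> (forall x, 0 <= f x) ->
  \int[mu]_x f x = \int[mu]_x f (- x)%R.
Proof.
move=> mf f0.
pose phi (x : measurableTypeR R) : measurableTypeR R := (- x)%R.
have mphi : measurable_fun setT phi by exact: oppr_measurable.
have mf' : measurable_fun (setT : set (measurableTypeR R)) f by [].
have f0' : {in [set: measurableTypeR R], forall y, 0 <= f y} by [].
have := @ge0_integral_pushforward _ _ _ _ _ phi mphi mu setT f measurableT mf' f0'.
rewrite preimage_setT /phi /= => <-.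
by apply: eq_measure_integral => A mA _; exact/esym/lebesgue_measureN.
Qed.

End affine.

(** * Measurability of explicit integrands *)

Section measurability.
Local Open Scope ereal_scope.
Context (R : realType) (d : measure_display) (T : measurableType d).

Lemma mfun_powR (f : T -> R) (p : R) :
  measurable_fun setT f -> measurable_fun setT (fun t => f t `^ p)%R.
Proof. exact: (measurableT_comp (measurable_powR p)). Qed.

Lemma mfun_expR (f : T -> R) :
  measurable_fun setT f -> measurable_fun setT (fun t => expR (f t)).
Proof. exact: (measurableT_comp (@measurable_expR R)). Qed.

Lemma mfun_norm (f : T -> R) :
  measurable_fun setT f -> measurable_fun setT (fun t => `|f t|%R).
Proof. exact: (measurableT_comp (@normr_measurable R setT)). Qed.

Lemma mfun_EFin (f : T -> R) :
  measurable_fun setT f -> measurable_fun setT (fun t => (f t)%:E).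
Proof. by move=> mf; apply/measurable_EFinP. Qed.

Lemma mfun_fst d1 d2 (T1 : measurableType d1) (T2 : measurableType d2)
    (f : T -> T1 * T2) :
  measurable_fun setT f -> measurable_fun setT (fun t => (f t).1).
Proof. exact: (measurableT_comp measurable_fst). Qed.

Lemma mfun_snd d1 d2 (T1 : measurableType d1) (T2 : measurableType d2)
    (f : T -> T1 * T2) :
  measurable_fun setT f -> measurable_fun setT (fun t => (f t).2).
Proof. exact: (measurableT_comp measurable_snd). Qed.

Lemma mfun_itv (f a b : T -> R) (b1 b2 : bool) :
  measurable_fun setT a -> measurable_fun setT b -> measurable_fun setT f ->
  measurable_fun setT
    (fun t => f t \in Interval (BSide b1 (a t)) (BSide b2 (b t))).
Proof.
move=> ma mb mf.
have -> : (fun t => f t \in Interval (BSide b1 (a t)) (BSide b2 (b t))) =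
  fun t => ((if b1 then a t <= f t else a t < f t) &&
            (if b2 then f t < b t else f t <= b t))%R.
  by apply/funext => t; rewrite in_itv /=; case: b1; case: b2.
apply: measurable_and; [case: b1|case: b2];
  by [exact: measurable_fun_ler|exact: measurable_fun_ltr].
Qed.

Lemma mfun_itvy (f a : T -> R) (b1 : bool) :
  measurable_fun setT a -> measurable_fun setT f ->
  measurable_fun setT (fun t => f t \in Interval (BSide b1 (a t)) +oo%O).
Proof.
move=> ma mf.
have -> : (fun t => f t \in Interval (BSide b1 (a t)) +oo%O) =
  fun t => (if b1 then a t <= f t else a t < f t)%R.
  by apply/funext => t; rewrite in_itv /= andbT; case: b1.
by case: b1; [exact: measurable_fun_ler|exact: measurable_fun_ltr].
Qed.

End measurability.

Ltac mfun1 := match goal with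
  | H : measurable_fun _ ?g |- measurable_fun _ ?f => constr_eq f g; exact: H
  | |- measurable_fun _ (fun=> _) => exact: measurable_cst
  | |- measurable_fun _ (-%R) => exact: oppr_measurable
  | |- measurable_fun _ fst => exact: measurable_fst
  | |- measurable_fun _ snd => exact: measurable_snd
  | |- measurable_fun _ (fun t => t) => exact: measurable_id
  | |- measurable_fun _ (fun t => (_, _)) => apply: measurable_fun_pair
  | |- measurable_fun _ (fun t => _%:E) => apply: mfun_EFin
  | |- measurable_fun _ (fun t => `|_|%R) => apply: mfun_norm
  | |- measurable_fun _ (fun t => (_ `^ _)%R) => apply: mfun_powR
  | |- measurable_fun _ (fun t => expR _) => apply: mfun_expR
  | |- measurable_fun _ (fun t => (_ * _)%R) => apply: measurable_funM
  | |- measurable_fun _ (fun t => (_ ^+ _)%R) => apply: measurable_funX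
  | |- measurable_fun _ (fun t => (_ - _)%R) => apply: measurable_funB
  | |- measurable_fun _ (fun t => (_ + _)%R) =>
      first [apply: measurable_funD | apply: emeasurable_funD]
  | |- measurable_fun _ (fun t => (- _)%R) => apply: measurable_funN
  | |- measurable_fun _ (fun t => (_ * _)%E) => apply: emeasurable_funM
  | |- measurable_fun _ (fun t => _.1) => apply: mfun_fst
  | |- measurable_fun _ (fun t => _.2) => apply: mfun_snd
  | |- measurable_fun _ (fun t => _ && _) => apply: measurable_and
  | |- measurable_fun _ (fun t => _ \in Interval (BSide _ _) (BSide _ _)) => apply: mfun_itv
  | |- measurable_fun _ (fun t => _ \in Interval (BSide _ _) +oo%O) => apply: mfun_itvy
  | H : measurable_fun setT ?f |- measurable_fun _ (fun t => ?f (@?g t)) =>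
      apply: (measurableT_comp H)
  end.

Ltac mfun := repeat mfun1.

(** * Exchange and substitution on intervals *)

Section interval_integrals.
Local Open Scope ereal_scope.
Context (R : realType).
Local Notation mu := (@lebesgue_measure R).
Implicit Types (f : R -> \bar R) (p : R -> bool) (q : R -> R -> bool).

(** The first hypothesis says that the two iterated integrals sweep the same region of the plane. *)
Lemma tonelli_dep p q p' q' (f : R -> R -> \bar R) :
  (forall x y, p x && q x y = p' y && q' x y) ->
  measurable_fun setT (fun z : R * R => p z.1 && q z.1 z.2) ->
  measurable_fun setT (fun z : R * R => f z.1 z.2) ->
  (forall x y, 0 <= f x y) ->
  \int[mu]_(x in [set x | p x]) \int[mu]_(y in [set y | q x y]) f x y =
  \int[mu]_(y in [set y | p' y]) \int[mu]_(x in [set x | q' x y]) f x y.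
Proof.
(* Where the outer condition fails the inner domain becomes empty, so the condition can be moved
   inside. *)
have nested (u : R -> bool) (v : R -> R -> bool) (g : R -> R -> \bar R) :
  \int[mu]_(x in [set x | u x]) \int[mu]_(y in [set y | v x y]) g x y =
  \int[mu]_x \int[mu]_(y in [set y | u x && v x y]) g x y.
  rewrite integral_mkcond; apply: eq_integral => x _; rewrite /patch mem_setE.
  rewrite -[x \in u]/(u x); case: (u x) => //=.
  rewrite (_ : (fun=> is_true false) = set0) ?integral_set0//.
  by apply/seteqP; split.
move=> pq mpq mf f0.
rewrite (nested p q f).
rewrite (@tonelli_rel R (fun x y => p x && q x y) f mpq mf f0).
rewrite (nested p' (fun y x => q' x y) (fun y x => f x y)).
by apply: eq_integral => y _; under eq_set do rewrite pq.
Qed.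

Lemma tonelli_itv (a b c e : R) (f : R -> R -> \bar R) :
  measurable_fun setT (fun z : R * R => f z.1 z.2) ->
  (forall x y, 0 <= f x y) ->
  \int[mu]_(x in `[a, b]) \int[mu]_(y in `[c, e]) f x y =
  \int[mu]_(y in `[c, e]) \int[mu]_(x in `[a, b]) f x y.
Proof.
move=> mf f0; apply: (@tonelli_dep (fun x => x \in `[a, b])
  (fun x y => y \in `[c, e]) (fun y => y \in `[c, e])
  (fun x y => x \in `[a, b])) => //.
- by move=> x y; rewrite andbC.
- by mfun.
Qed.

Lemma tonelli_triangle (a b : R) (f : R -> R -> \bar R) :
  measurable_fun setT (fun z : R * R => f z.1 z.2) ->
  (forall x y, 0 <= f x y) ->
  \int[mu]_(x in `[a, b]) \int[mu]_(y in `[a, x]) f x y =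
  \int[mu]_(y in `[a, b]) \int[mu]_(x in `[y, b]) f x y.
Proof.
move=> mf f0; apply: (@tonelli_dep (fun x => x \in `[a, b])
  (fun x y => y \in `[a, x]) (fun y => y \in `[a, b])
  (fun x y => x \in `[y, b])) => //.
- by move=> x y; rewrite !in_itv /=; apply/idP/idP; lra.
- by mfun.
Qed.

Lemma measurable_integral_itv d (T : measurableType d) (a b : T -> R)
    (f : T -> R -> \bar R) :
  measurable_fun setT a -> measurable_fun setT b ->
  measurable_fun setT (fun z : T * R => f z.1 z.2) ->
  (forall t x, 0 <= f t x) ->
  measurable_fun setT (fun t => \int[mu]_(x in `[a t, b t]) f t x).
Proof.
move=> ma mb mf f0.
apply: (@emeasurable_fun_integral R _ T (fun t x => x \in `[a t, b t])) => //.
apply: mfun_itv; last by mfun.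
- exact: (measurableT_comp ma measurable_fst).
- exact: (measurableT_comp mb measurable_fst).
Qed.

Lemma ge0_integral_itv_affine (a b c e : R) f : (0 < a)%R ->
  measurable_fun setT f -> (forall x, 0 <= f x) ->
  \int[mu]_(x in `[(a * c + b)%R, (a * e + b)%R]) f x =
  a%:E * \int[mu]_(x in `[c, e]) f (a * x + b)%R.
Proof.
move=> a0 mf f0.
rewrite integral_mkcond (ge0_integral_affine b a0); first last.
- by move=> x; rewrite /patch; case: ifP.
- by apply/(measurable_restrictT _ _).1 => //; exact: measurable_funTS.
congr (_ * _); rewrite [RHS]integral_mkcond; apply: eq_integral => x _.
by rewrite /patch !mem_setE !in_itv/= !lerD2r !ler_pM2l.
Qed.

Lemma ge0_integral_itv_shift (c a b : R) f :
  measurable_fun setT f -> (forall x, 0 <= f x) ->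
  \int[mu]_(x in `[(a + c)%R, (b + c)%R]) f x =
  \int[mu]_(x in `[a, b]) f (x + c)%R.
Proof.
move=> mf f0; have := @ge0_integral_itv_affine 1 c a b f ltr01 mf f0.
by rewrite !mul1r mul1e => ->; under eq_integral do rewrite mul1r.
Qed.

Lemma ge0_integral_itv_scale (c b : R) f : (0 < c)%R ->
  measurable_fun setT f -> (forall x, 0 <= f x) ->
  \int[mu]_(x in `[0%R, (c * b)%R]) f x =
  c%:E * \int[mu]_(x in `[0%R, b]) f (c * x)%R.
Proof.
move=> c0 mf f0; have := @ge0_integral_itv_affine c 0 0 b f c0 mf f0.
by rewrite mulr0 !addr0 => ->; under eq_integral do rewrite addr0.
Qed.

Lemma ge0_integral_itv_refl (c a b : R) f :
  measurable_fun setT f -> (forall x, 0 <= f x) ->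
  \int[mu]_(x in `[a, b]) f x =
  \int[mu]_(x in `[(c - b)%R, (c - a)%R]) f (c - x)%R.
Proof.
move=> mf f0.
have -> : \int[mu]_(x in `[a, b]) f x =
    \int[mu]_(x in `[(- b)%R, (- a)%R]) f (- x)%R.
  rewrite integral_mkcond ge0_integral_opp; first last.
  - by move=> x; rewrite /patch; case: ifP.
  - by apply/(measurable_restrictT _ _).1 => //; exact: measurable_funTS.
  rewrite [RHS]integral_mkcond; apply: eq_integral => x _.
  rewrite /patch !mem_setE !in_itv/= lerNr lerNl andbC.
  by congr (if _ then _ else _); rewrite andbC.
have := @ge0_integral_itv_shift (- c)%R (c - b)%R (c - a)%R (fun x => f (- x)%R).
have e u : (c - u + - c)%R = (- u)%R by ring.
rewrite !e => ->//.
- by under eq_integral do rewrite opprD opprK addrC.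
- by apply: (measurableT_comp mf); exact: oppr_measurable.
Qed.

Lemma ge0_integral_itv_split (c a b : R) f :
  measurable_fun setT f -> (forall x, 0 <= f x) -> (a <= c <= b)%R ->
  \int[mu]_(x in `[a, b]) f x =
  \int[mu]_(x in `[a, c]) f x + \int[mu]_(x in `[c, b]) f x.
Proof.
move=> mf f0 /andP[ac cb].
(* Removing the null point [c] from the second piece makes the two pieces disjoint. *)
rewrite -[X in _ + X]integral_itv_obnd_cbnd; last exact: measurable_funTS.
rewrite -ge0_integral_setU//=.
- by rewrite -itv_bndbnd_setU// bnd_simp.
- exact: measurable_funTS.
- apply/disj_setPS => x [] /=; rewrite !in_itv/= => /andP[_ xc] /andP[cx _].
  by move: (lt_le_trans cx xc); rewrite ltxx.
Qed.

End interval_integrals.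

(** * Chains of kernels *)

Section chains.
Local Open Scope ereal_scope.
Context (R : realType) (d : R).
Local Notation mu := (@lebesgue_measure R).

Definition riesz (x y : R) : \bar R := (`|x - y| `^ (- d))%:E.

(** The [n] intermediate points are confined to [[0, L]], the endpoints are not. Keeping [L] free
    makes the family stable under scaling and under splitting at the largest point. *)
Fixpoint chain (n : nat) (L x y : R) : \bar R :=
  if n is m.+1 then \int[mu]_(z in `[0%R, L]) (riesz x z * chain m L z y)
  else riesz x y.

Arguments chain : simpl never.

Lemma chain0 L x y : chain 0 L x y = riesz x y. Proof. by []. Qed.

Lemma chainS n L x y : chain n.+1 L x y =
  \int[mu]_(z in `[0%R, L]) (riesz x z * chain n L z y).
Proof. by []. Qed.

Lemma riesz_ge0 x y : 0 <= riesz x y.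
Proof. by rewrite lee_fin powR_ge0. Qed.

Lemma rieszC x y : riesz x y = riesz y x.
Proof. by rewrite /riesz distrC. Qed.

Lemma measurable_riesz e (T : measurableType e) (f g : T -> R) :
  measurable_fun setT f -> measurable_fun setT g ->
  measurable_fun setT (fun t => riesz (f t) (g t)).
Proof. by move=> mf mg; rewrite /riesz; mfun. Qed.

Lemma chain_ge0 n L x y : 0 <= chain n L x y.
Proof.
elim: n L x y => [|n IH] L x y; first exact: riesz_ge0.
by apply: integral_ge0 => z _; apply: mule_ge0; rewrite ?riesz_ge0.
Qed.

Lemma measurable_chain n e (T : measurableType e) (l f g : T -> R) :
  measurable_fun setT l -> measurable_fun setT f -> measurable_fun setT g ->
  measurable_fun setT (fun t => chain n (l t) (f t) (g t)).
Proof.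
move=> ml mf mg.
elim: n e T l f g ml mf mg => [|n IH] e T l f g ml mf mg.
  exact: measurable_riesz.
apply: measurable_integral_itv => //.
  by apply: emeasurable_funM; [apply: measurable_riesz|apply: IH]; mfun.
by move=> t x; apply: mule_ge0; [exact: riesz_ge0|exact: chain_ge0].
Qed.

Local Hint Resolve riesz_ge0 chain_ge0 : core.

Ltac mchain := repeat first [mfun1 | match goal with
  | |- measurable_fun _ (fun t => riesz _ _) => apply: measurable_riesz
  | |- measurable_fun _ (fun t => chain _ _ _ _) => apply: measurable_chain
  | |- measurable_fun _ (riesz ?x) =>
      apply: (@measurable_riesz _ _ (fun=> x) (fun t => t))
  | |- measurable_fun _ (chain ?n ?l ?x) =>
      apply: (@measurable_chain n _ _ (fun=> l) (fun=> x) (fun t => t))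
  end].

(** A Chapman-Kolmogorov rule: the junction [z] becomes an intermediate point itself, hence the
    successor in [(i + j).+1]. *)
Lemma chain_comp i j L x y :
  \int[mu]_(z in `[0%R, L]) (chain i L x z * chain j L z y) =
  chain (i + j).+1 L x y.
Proof.
elim: i x => [//|i IH] x.
have h z w : 0 <= riesz x w * chain i L w z * chain j L z y.
  by rewrite !mule_ge0.
transitivity (\int[mu]_(z in `[0%R, L]) \int[mu]_(w in `[0%R, L])
    (riesz x w * chain i L w z * chain j L z y)).
  apply: eq_integral => z _ /=; rewrite ge0_integralZr//.
  - by apply: measurable_funTS; mchain.
  - by move=> w _; rewrite mule_ge0.
rewrite tonelli_itv//; last by mchain.
rewrite addSn chainS; apply: eq_integral => w _ /=; rewrite -IH -ge0_integralZl//.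
- by apply: eq_integral => z _; rewrite muleA.
- by apply: measurable_funTS; mchain.
- by move=> z _; rewrite mule_ge0.
Qed.

Lemma chainC n L x y : chain n L x y = chain n L y x.
Proof.
elim: n x y => [|n IH] x y; first exact: rieszC.
(* The right side is cut at its last intermediate point, the left side at its first. *)
rewrite -[in RHS](addn0 n) -chain_comp chainS.
by apply: eq_integral => z _; rewrite IH rieszC muleC.
Qed.

(** Each of the [n] integrations contributes a factor [c], and each of the [n + 1] kernels a factor
    [c^(-d)]. *)
Lemma chain_scale n (c L x y : R) : (0 < c)%R ->
  chain n (c * L)%R (c * x)%R (c * y)%R =
  (c `^ (n%:R - n.+1%:R * d))%:E * chain n L x y.
Proof.
move=> c0; have cn0 : c != 0%R by rewrite gt_eqF.
have rs u v : riesz (c * u)%R (c * v)%R = (c `^ (- d))%:E * riesz u v.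
  by rewrite /riesz -mulrBr normrM (gtr0_norm c0) powRM// ltW.
elim: n x y => [|n IH] x y; first by rewrite !chain0 rs sub0r mul1r.
rewrite !chainS [LHS](@ge0_integral_itv_scale R c L _ c0); first last.
- by move=> z; rewrite mule_ge0.
- by mchain.
under eq_integral do rewrite rs IH muleACA -EFinM.
rewrite ge0_integralZl//; first last.
- by rewrite lee_fin mulr_ge0// powR_ge0.
- by move=> z _; rewrite mule_ge0.
- by apply: measurable_funTS; mchain.
rewrite muleA -EFinM; congr (_%:E * _).
rewrite -[X in (X * _)%R]powRr1 ?(ltW c0)// -!powRD ?cn0 ?implybT//.
by congr powR; rewrite -[n.+2%:R]natr1 -[n.+1%:R]natr1; ring.
Qed.

Lemma chain_refl n (L x y : R) :
  chain n L (L - x)%R (L - y)%R = chain n L x y.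
Proof.
have rr u v : riesz (L - u)%R (L - v)%R = riesz u v.
  by rewrite rieszC /riesz (_ : _ - _ = u - v)%R //; ring.
elim: n x y => [|n IH] x y; first by rewrite !chain0 rr.
rewrite !chainS [LHS](ge0_integral_itv_refl L); first last.
- by move=> z; rewrite mule_ge0.
- by mchain.
by rewrite subrr subr0; apply: eq_integral => z _; rewrite rr IH.
Qed.

(* Splits a chain in [0, M] at its largest intermediate point. *)
Lemma chain_split n M x y :
  chain n.+1 M x y =
  \sum_(i < n.+1) \int[mu]_(l in `[0%R, M])
    (chain i l x l * chain (n - i) l l y).
Proof.
elim: n M x y => [|n IH] M x y; first by rewrite big_ord1.
rewrite chainS big_ord_recl subn0.
have g0 (i : 'I_n.+1) z l : 0 <= riesz x z * (chain i l z l * chain (n - i) l l y).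
  by rewrite !mule_ge0.
have mg (i : 'I_n.+1) : measurable_fun setT (fun p : R * R =>
    riesz x p.1 * (chain i p.2 p.1 p.2 * chain (n - i) p.2 p.2 y)).
  by mchain.
(* Here [z] is the first intermediate point and [l] the largest of the others. The part [l <= z]
   reassembles, by the induction hypothesis on [[0, z]], into the term where [z] is the largest; the
   part [l >= z] gives the remaining terms. *)
transitivity (\int[mu]_(z in `[0%R, M]) (riesz x z * chain n.+1 z z y +
    \sum_(i < n.+1) \int[mu]_(l in `[z, M])
      (riesz x z * (chain i l z l * chain (n - i) l l y)))).
  apply: eq_integral => z; rewrite inE/= in_itv/= => zM.
  rewrite !IH.
  transitivity (riesz x z * (\sum_(i < n.+1) (\int[mu]_(l in `[0%R, z])
      (chain i l z l * chain (n - i) l l y) + \int[mu]_(l in `[z, M])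
      (chain i l z l * chain (n - i) l l y)))).
    congr (_ * _); apply: eq_bigr => i _; apply: ge0_integral_itv_split => //.
    - by mchain.
    - by move=> l; rewrite mule_ge0.
  rewrite big_split/= ge0_muleDr; first last.
  - by apply: sume_ge0 => i _; apply: integral_ge0 => l _; rewrite mule_ge0.
  - by apply: sume_ge0 => i _; apply: integral_ge0 => l _; rewrite mule_ge0.
  congr (_ + _); rewrite ge0_sume_distrr; last first.
    by move=> i _; apply: integral_ge0 => l _; rewrite mule_ge0.
  apply: eq_bigr => i _; rewrite ge0_integralZl//.
  - by apply: measurable_funTS; mchain.
  - by move=> l _; rewrite mule_ge0.
have mi (i : 'I_n.+1) : measurable_fun setT (fun z : R => \int[mu]_(l in `[z, M])
      (riesz x z * (chain i l z l * chain (n - i) l l y))).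
  by apply: (@measurable_integral_itv R _ _ (fun z => z) (fun=> M)) => //; mchain.
have i0 (i : 'I_n.+1) z : 0 <= \int[mu]_(l in `[z, M])
      (riesz x z * (chain i l z l * chain (n - i) l l y)).
  exact: integral_ge0.
rewrite ge0_integralD//; first last.
- by apply: measurable_funTS; apply: emeasurable_sum.
- by move=> z _; apply: sume_ge0.
- by apply: measurable_funTS; mchain.
- by move=> z _; apply: mule_ge0 => //.
congr (_ + _).
rewrite ge0_integral_sum//; last by move=> i; apply: measurable_funTS; exact: mi.
(* On the triangle [z <= l], integrating over [z] first lets the left half absorb [z] and grow from
   [i] to [i + 1] points. *)
apply: eq_bigr => i _; rewrite -(tonelli_triangle 0%R M (f := fun l z =>
    riesz x z * (chain i l z l * chain (n - i) l l y)))//; last by mchain.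
apply: eq_integral => l _; rewrite lift0 subSS chainS -ge0_integralZr//.
- by apply: eq_integral => z _; rewrite muleA.
- by apply: measurable_funTS; mchain.
- by move=> z _; rewrite mule_ge0.
Qed.

(** The largest of the [n + 2] points of a closed chain can occupy any of the [n + 2] places, and
    rotating the cycle makes these contributions equal. Either the base point [x] is the largest, or
    the two arcs at the largest point [l] are joined at [x] by [chain_comp]. *)
Lemma chain_trace n M :
  \int[mu]_(x in `[0%R, M]) chain n.+1 M x x =
  n.+2%:R%:E * \int[mu]_(l in `[0%R, M]) chain n.+1 l l l.
Proof.
have mg (i : 'I_n.+1) : measurable_fun setT (fun p : R * R =>
    chain i p.1 p.2 p.1 * chain (n - i) p.1 p.1 p.2).
  by mchain.
have g0 (i : 'I_n.+1) x l : 0 <= chain i l x l * chain (n - i) l l x.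
  by rewrite !mule_ge0.
transitivity (\int[mu]_(x in `[0%R, M]) (chain n.+1 x x x +
    \sum_(i < n.+1) \int[mu]_(l in `[x, M])
      (chain i l x l * chain (n - i) l l x))).
  apply: eq_integral => x; rewrite inE/= in_itv/= => xM.
  rewrite !chain_split -big_split/=; apply: eq_bigr => i _.
  by apply: ge0_integral_itv_split => //; mchain.
have mi (i : 'I_n.+1) : measurable_fun setT (fun x : R => \int[mu]_(l in `[x, M])
      (chain i l x l * chain (n - i) l l x)).
  by apply: (@measurable_integral_itv R _ _ (fun z => z) (fun=> M)) => //; mchain.
have i0 (i : 'I_n.+1) x : 0 <= \int[mu]_(l in `[x, M])
      (chain i l x l * chain (n - i) l l x).
  exact: integral_ge0.
rewrite ge0_integralD//; first last.
- by apply: measurable_funTS; apply: emeasurable_sum.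
- by move=> z _; apply: sume_ge0.
- by apply: measurable_funTS; mchain.
rewrite ge0_integral_sum//; last by move=> i; apply: measurable_funTS; exact: mi.
transitivity (\int[mu]_(l in `[0%R, M]) chain n.+1 l l l +
  \sum_(i < n.+1) \int[mu]_(l in `[0%R, M]) chain n.+1 l l l).
  congr (_ + _); apply: eq_bigr => i _.
  rewrite -(tonelli_triangle 0%R M (f := fun l z =>
    (chain i l z l * chain (n - i) l l z)))//.
  apply: eq_integral => l _.
  under eq_integral do rewrite muleC.
  by rewrite chain_comp subnK// -ltnS.
set I := \int[mu]_(_ in _) _.
by rewrite sumr_const card_ord mule_natl -mulrS.
Qed.

End chains.

Arguments chain : simpl never.

(** * The Gamma and Beta integrals *)

Section euler.
Local Open Scope ereal_scope.
Context (R : realType).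
Local Notation mu := (@lebesgue_measure R).

(** The Euler integrals stay in [\bar R], so that Tonelli applies before anything is known to be
    finite. *)
Definition betaI (a b : R) : \bar R :=
  \int[mu]_(t in `[0%R, 1%R]) (t `^ (a - 1) * (1 - t) `^ (b - 1))%:E.

Definition gammaI (a : R) : \bar R :=
  \int[mu]_(t in `]0%R, +oo[) (t `^ (a - 1) * expR (- t))%:E.

Lemma GammaE a : Gamma a = fine (gammaI a). Proof. by []. Qed.

Lemma powR_continuous_pt (p x : R) : (0 < x)%R -> {for x, continuous (@powR R ^~ p)}.
Proof.
move=> x0; apply: differentiable_continuous; apply/derivable1_diffP.
by apply: derivable_powR; rewrite in_itv/= x0.
Qed.

Lemma integral_powR_away (p c : R) : p != 0%R -> (0 < c < 1)%R ->
  \int[mu]_(x in `[c, 1%R]) (x `^ (p - 1))%:E = (p^-1 * (1 - c `^ p))%:E.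
Proof.
move=> p0 /andP[c0 c1].
rewrite (@continuous_FTC2 _ _ (fun x => p^-1 * x `^ p)%R)//.
- by rewrite -EFinB powR1 mulrBr.
- apply: continuous_in_subspaceT => x; rewrite inE/= in_itv/= => /andP[cx _].
  by apply: powR_continuous_pt; rewrite (lt_le_trans c0).
- have cF x : (0 < x)%R -> {for x, continuous (fun x => p^-1 * x `^ p)%R}.
    move=> x0; apply: (@continuousM _ R^o (fun=> p^-1%R)).
      exact: cst_continuous.
    exact: powR_continuous_pt.
  split.
  + move=> x; rewrite in_itv/= => /andP[cx _].
    apply: derivableM => //; apply: derivable_powR.
    by rewrite in_itv/= (lt_trans c0).
  + by apply: cvg_at_right_filter; exact: cF.
  + by apply: cvg_at_left_filter; exact: cF.
- move=> x; rewrite in_itv/= => /andP[cx _].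
  have x0 : (0 < x)%R by exact: lt_trans cx.
  have dx : derivable (@powR R ^~ p) x 1.
    by apply: derivable_powR; rewrite in_itv/= x0.
  rewrite derive1E deriveM// derive_cst scaler0 addr0 -derive1E.
  rewrite powR_derive1 ?in_itv/= ?x0//.
  by rewrite /GRing.scale/= mulrA mulVf// mul1r.
Qed.

(** For [p < 1] the integrand is singular at 0: the fundamental theorem of calculus is applied on
    [[c, 1]], and monotone convergence lets [c] tend to 0. *)
Lemma integral_powR (p : R) : (0 < p)%R ->
  \int[mu]_(x in `[0%R, 1%R]) (x `^ (p - 1))%:E = p^-1%:E.
Proof.
move=> p0.
have mf : measurable_fun setT (fun x : R => (x `^ (p - 1))%:E) by mfun.
rewrite -integral_itv_obnd_cbnd; last exact: measurable_funTS.
(* The shift by 2 keeps the left endpoint strictly below 1, as [integral_powR_away] requires. *)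
pose F (i : nat) : set R := `[(i.+2%:R^-1)%R, 1%R]%classic.
have -> : `]0%R, 1%R]%classic = \bigcup_i F i.
  apply/seteqP; split=> [x /=|x [i _]]; rewrite /F/= !in_itv/=.
    move=> /andP[x0 x1]; exists (Num.truncn x^-1) => //=; rewrite in_itv/= x1 andbT.
    rewrite invf_ple ?posrE// (le_trans (ltW (truncnS_gt _)))//.
    by rewrite ler_nat.
  by move=> /andP[ix ->]; rewrite andbT (lt_le_trans _ ix).
have ndF : nondecreasing_seq F.
  apply/nondecreasing_seqP => n; apply/subsetPset => x.
  rewrite /F/= !in_itv/= => /andP[nx ->]; rewrite andbT (le_trans _ nx)//.
  by rewrite lef_pV2 ?posrE// ler_nat.
have := @ge0_nondecreasing_set_cvg_integral _ (measurableTypeR R) R F _ mu ndF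
  (fun i => measurable_itv _) (fun i => measurable_funTS mf).
move=> /(_ (fun i x _ => powR_ge0 _ _)).
under eq_fun.
  move=> i; rewrite integral_powR_away ?gt_eqF//; last first.
    by rewrite invr_gt0 ltr0n/= invf_lt1 ?ltr1n.
  over.
move=> /(cvg_lim (@ereal_hausdorff R)) <-; apply: (cvg_lim (@ereal_hausdorff R)).
have -> : p^-1%:E = (p^-1 * (1 - 0))%:E by rewrite subr0 mulr1.
apply: cvg_EFin; first by apply: nearW.
apply: cvgM; first exact: cvg_cst.
apply: cvgB; first exact: cvg_cst.
move/cvg_at_rightP : (powR_cvg0 p0) => /(_ (fun i => i.+2%:R^-1)%R); apply.
split=> [n|]; first by rewrite invr_gt0.
have := @cvg_harmonic R; rewrite -cvg_shiftS; exact.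
Qed.

Implicit Types a b u : R.

Lemma betaI_ge0 a b : 0 <= betaI a b.
Proof. by apply: integral_ge0 => x _; rewrite lee_fin mulr_ge0 ?powR_ge0 ?expR_ge0. Qed.

Lemma gammaI_ge0 a : 0 <= gammaI a.
Proof. by apply: integral_ge0 => x _; rewrite lee_fin mulr_ge0 ?powR_ge0 ?expR_ge0. Qed.

Lemma betaI_scale a b u : (0 < u)%R ->
  \int[mu]_(x in `[0%R, u]) (x `^ (a - 1) * (u - x) `^ (b - 1))%:E =
  (u `^ (a + b - 1))%:E * betaI a b.
Proof.
move=> u0; have un0 : u != 0%R by rewrite gt_eqF.
have -> : `[0%R, u]%classic = `[0%R, (u * 1)%R]%classic by rewrite mulr1.
rewrite [LHS](@ge0_integral_itv_scale R u 1 _ u0); first last.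
- by move=> x; rewrite lee_fin mulr_ge0 ?powR_ge0.
- by mfun.
have -> : (u `^ (a + b - 1) = u * (u `^ (a - 1) * u `^ (b - 1)))%R.
  rewrite -{2}[u]powRr1 ?(ltW u0)// -!powRD ?un0 ?implybT//.
  by congr powR; ring.
rewrite EFinM -muleA; congr (_ * _).
rewrite -ge0_integralZl//; first last.
- by rewrite lee_fin mulr_ge0 ?powR_ge0.
- by move=> x _; rewrite lee_fin mulr_ge0 ?powR_ge0.
- by apply: measurable_funTS; mfun.
apply: eq_integral => t; rewrite inE/= in_itv/= => /andP[t0 t1].
rewrite -EFinM -{2}[u]mulr1 -mulrBr !powRM ?subr_ge0 ?(ltW u0)//.
by congr EFin; ring.
Qed.

Lemma betaIC a b : betaI a b = betaI b a.
Proof.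
rewrite /betaI [LHS](ge0_integral_itv_refl 1); first last.
- by move=> x; rewrite lee_fin mulr_ge0 ?powR_ge0.
- by mfun.
rewrite subrr subr0; apply: eq_integral => x _.
by rewrite mulrC subKr.
Qed.

Lemma betaI1 a : (0 < a)%R -> betaI a 1 = a^-1%:E.
Proof.
move=> a0; rewrite -integral_powR//; apply: eq_integral => x _.
by rewrite subrr powRr0 mulr1.
Qed.

Lemma ge0_integral_itvy_shift (c : R) (f : R -> \bar R) :
  measurable_fun setT f -> (forall x, 0 <= f x) ->
  \int[mu]_(x in `]0%R, +oo[) f x = \int[mu]_(x in `]c, +oo[) f (x - c)%R.
Proof.
move=> mf f0; rewrite integral_mkcond (@ge0_integral_affine R 1 (- c))//; first last.
- by move=> x; rewrite /patch; case: ifP.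
- by apply/(measurable_restrictT _ _).1 => //; exact: measurable_funTS.
rewrite mul1e [RHS]integral_mkcond; apply: eq_integral => x _.
by rewrite mul1r /patch !mem_setE !in_itv/= subr_gt0.
Qed.

(* With [u = x + y], Tonelli turns the product into a Laplace transform of the
   convolution of [x^(a-1)] and [y^(b-1)]. *)
Lemma gammaI_betaI a b : gammaI a * gammaI b = gammaI (a + b) * betaI a b.
Proof.
pose g x u : \bar R :=
  (x `^ (a - 1) * (u - x) `^ (b - 1) * expR (- u))%:E.
have g0 x u : 0 <= g x u.
  by rewrite lee_fin !mulr_ge0 ?powR_ge0 ?expR_ge0.
have mg : measurable_fun setT (fun z : R * R => g z.1 z.2).
  by rewrite /g; mfun.
transitivity (\int[mu]_(x in `]0%R, +oo[) \int[mu]_(u in `]x, +oo[) g x u).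
  rewrite /gammaI -ge0_integralZr//; first last.
  - exact: gammaI_ge0.
  - by move=> x _; rewrite lee_fin mulr_ge0 ?powR_ge0 ?expR_ge0.
  - by apply: measurable_funTS; mfun.
  apply: eq_integral => x _; rewrite (ge0_integral_itvy_shift x); first last.
  - by move=> y; rewrite lee_fin mulr_ge0 ?powR_ge0 ?expR_ge0.
  - by mfun.
  rewrite -ge0_integralZl//; first last.
  - by rewrite lee_fin mulr_ge0 ?powR_ge0 ?expR_ge0.
  - by move=> y _; rewrite lee_fin mulr_ge0 ?powR_ge0 ?expR_ge0.
  - by apply: measurable_funTS; mfun.
  apply: eq_integral => u _; rewrite -EFinM /g; congr EFin.
  have -> : expR (- u) = (expR (- x) * expR (- (u - x)))%R.
    by rewrite -expRD; congr expR; ring.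
  by ring.
rewrite (@tonelli_dep R (fun x => x \in `]0%R, +oo[) (fun x u => u \in `]x, +oo[)
  (fun u => u \in `]0%R, +oo[) (fun x u => x \in `]0%R, u[))//; first last.
- by mfun.
- move=> x u; rewrite !in_itv/= !andbT.
  by apply/idP/idP => [/andP[x0 xu]|/and3P[u0 x0 xu]];
    rewrite ?x0 ?xu ?(lt_trans x0 xu).
rewrite /gammaI -ge0_integralZr//; first last.
- exact: betaI_ge0.
- by move=> x _; rewrite lee_fin mulr_ge0 ?powR_ge0 ?expR_ge0.
- by apply: measurable_funTS; mfun.
apply: eq_integral => u; rewrite inE/= in_itv/= andbT => u0.
rewrite EFinM muleAC -betaI_scale// -ge0_integralZr//; first last.
- by move=> x _; rewrite lee_fin mulr_ge0 ?powR_ge0.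
- by apply: measurable_funTS; mfun.
rewrite -(integral_itv_bndoo true false); last first.
  by apply: measurable_funTS; rewrite /g; mfun.
by apply: eq_integral => x _.
Qed.

Lemma gammaI1 : gammaI (1 : R) = 1.
Proof.
rewrite -(@integral_exponential_pdf R 1 ltr01) /gammaI.
rewrite integral_itv_obnd_cbnd; last by apply: measurable_funTS; mfun.
rewrite integral_mkcond; apply: eq_integral => x _.
rewrite /exponential_pdf /patch; case: ifP => // _.
by rewrite subrr powRr0 !mul1r mulN1r.
Qed.

(** This is [gammaI_betaI] at [b = 1], where the Gamma integral is 1 and [betaI a 1] is [1 / a]. *)
Lemma gammaIS a : (0 < a)%R -> gammaI (a + 1) = a%:E * gammaI a.
Proof.
move=> a0; have := gammaI_betaI a 1.
rewrite gammaI1 mule1 betaI1// => ->.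
by rewrite muleCA -EFinM mulfV ?gt_eqF// mule1.
Qed.

Lemma gammaI_nat n : gammaI (n.+1%:R : R) = n`!%:R%:E.
Proof.
elim: n => [|n IH]; first exact: gammaI1.
by rewrite -natr1 gammaIS// IH -EFinM -natrM factS.
Qed.

(** For [b >= 1] the factor [(1 - t)^(b - 1)] is at most 1, so [betaI a 1] dominates. *)
Lemma betaI_lty a b : (0 < a)%R -> (1 <= b)%R -> betaI a b < +oo.
Proof.
move=> a0 b1; apply: (@le_lt_trans _ _ (betaI a 1)); last first.
  by rewrite betaI1// ltry.
apply: ge0_le_integral => //.
- by move=> x _; rewrite lee_fin mulr_ge0 ?powR_ge0.
- by apply: measurable_funTS; mfun.
- by apply: measurable_funTS; mfun.
- move=> x /=; rewrite in_itv/= => /andP[x0 x1].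
  rewrite lee_fin ler_wpM2l ?powR_ge0// subrr powRr0.
  have e : (1 `^ (b - 1) = 1)%R by rewrite powR1.
  rewrite -[leRHS]e ge0_ler_powR// ?subr_ge0 ?nnegrE ?subr_ge0//.
  by rewrite gerBl.
Qed.

(** For exponents at least 1 the integrand is at least [exp(-2)] on [[1, 2]]; the recurrence carries
    positivity down to every [a > 0]. *)
Lemma gammaI_gt0 a : (0 < a)%R -> 0 < gammaI a.
Proof.
have main b : (1 <= b)%R -> 0 < gammaI b.
  move=> b1; apply: (@lt_le_trans _ _ (\int[mu]_(x in `[1%R, 2%R]) (expR (- 2))%:E)).
    rewrite integral_cst//= lebesgue_measure_itv/= lte_fin ltr1n.
    by rewrite -EFinB -EFinM lte_fin mulr_gt0 ?expR_gt0// subr_gt0 ltr1n.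
  apply: (@le_trans _ _ (\int[mu]_(x in `[1%R, 2%R]) (x `^ (b - 1) * expR (- x))%:E)).
    apply: ge0_le_integral => //.
    - by apply: measurable_funTS; mfun.
    - move=> x /=; rewrite in_itv/= => /andP[x1 x2].
      rewrite lee_fin -[leLHS]mul1r ler_pM ?expR_ge0//.
      + have e : (1 `^ (b - 1) = 1)%R by rewrite powR1.
        rewrite -[leLHS]e ge0_ler_powR// ?subr_ge0 ?nnegrE//.
        by rewrite (le_trans _ x1).
      + by rewrite ler_expR lerN2.
  apply: ge0_subset_integral => //.
  - by apply: measurable_funTS; mfun.
  - by move=> x _; rewrite lee_fin mulr_ge0 ?powR_ge0 ?expR_ge0.
  - by move=> x /=; rewrite !in_itv/= andbT => /andP[x1 _]; rewrite (lt_le_trans _ x1).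
move=> a0; have : 0 < gammaI (a + 1) by apply: main; rewrite lerDr ltW.
by rewrite gammaIS// pmule_rgt0.
Qed.

(** Choose [b >= 1] with [a + b] an integer. Then [gammaI a * gammaI b] is a factorial times a
    finite Beta integral, and [gammaI b] is positive, so [gammaI a] cannot be infinite. *)
Lemma gammaI_lty a : (0 < a)%R -> gammaI a < +oo.
Proof.
move=> a0; pose n := Num.truncn a; pose b := (n.+2%:R - a)%R.
have b1 : (1 <= b)%R.
  by rewrite /b -natr1 lerBrDr addrC lerD2r ltW// truncnS_gt.
have := gammaI_betaI a b.
have -> : (a + b = n.+2%:R)%R by rewrite /b; ring.
rewrite gammaI_nat => h.
rewrite ltey; apply/negP => /eqP ay.
have := betaI_lty a0 b1.
have : 0 < gammaI b by apply: gammaI_gt0; exact: lt_le_trans b1.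
move: h; rewrite ay => h b0.
move: h; rewrite gt0_mulye// => h.
rewrite ltey => /negP; apply; apply/eqP.
move: h; case: (betaI a b) (betaI_ge0 a b) => // r r0.
Qed.

Lemma gammaI_Gamma a : (0 < a)%R -> gammaI a = (Gamma a)%:E.
Proof.
by move=> a0; rewrite GammaE fineK// ge0_fin_numE ?gammaI_ge0 ?gammaI_lty.
Qed.

Lemma Gamma_gt0 a : (0 < a)%R -> (0 < Gamma a)%R.
Proof. by move=> a0; rewrite -lte_fin -gammaI_Gamma// gammaI_gt0. Qed.

Lemma Gamma_recur a : (0 < a)%R -> (Gamma (a + 1) = a * Gamma a)%R.
Proof.
move=> a0; apply: EFin_inj; rewrite EFinM -!gammaI_Gamma ?gammaIS//.
by rewrite addr_gt0.
Qed.

Lemma betaIE a b : (0 < a)%R -> (0 < b)%R ->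
  betaI a b = (Gamma a * Gamma b / Gamma (a + b))%:E.
Proof.
move=> a0 b0; have := gammaI_betaI a b.
rewrite !gammaI_Gamma ?addr_gt0// => h.
rewrite EFinM [(Gamma a * _)%:E]EFinM h muleAC -EFinM mulfV ?mul1e//.
by rewrite gt_eqF// Gamma_gt0// addr_gt0.
Qed.

End euler.

(** * Reduction of the cyclic integral to chains *)

Section cumulant_chain.
Local Open Scope ereal_scope.
Context (R : realType) (d : R).
Local Notation mu := (@lebesgue_measure R).
Local Notation chain := (chain d).
Local Notation riesz := (riesz d).

Lemma ge0_itv_integralZl (L : R) (c : \bar R) (f : R -> \bar R) :
  0 <= c -> measurable_fun setT f -> (forall x, 0 <= f x) ->
  \int[mu]_(x in `[0%R, L]) (c * f x) = c * \int[mu]_(x in `[0%R, L]) f x.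
Proof.
by move=> c0 mf f0; rewrite ge0_integralZl//; exact: measurable_funTS.
Qed.

Lemma measurable_riesz_chain n L x y :
  measurable_fun setT (fun z : R => riesz x z * chain n L z y).
Proof.
apply: emeasurable_funM.
- exact: (@measurable_riesz _ _ _ _ (fun=> x) (fun t => t)).
- exact: (@measurable_chain _ _ n _ _ (fun=> L) (fun t => t) (fun=> y)).
Qed.

Lemma cyclic_integral5 :
  cyclic_integral d 5 = \int[mu]_(x in `[0%R, 1%R]) chain 4 1 x x.
Proof.
(* The cyclic product sits under the innermost integral, whereas a chain keeps each kernel as far
   out as possible; [step] moves the factor collected so far across one integral. *)
have step c n L x y : 0 <= c ->
    \int[mu]_(z in `[0%R, L]) (c * (riesz x z * chain n L z y)) =
    c * chain n.+1 L x y.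
  move=> c0; rewrite ge0_itv_integralZl//; first exact: measurable_riesz_chain.
  by move=> z; rewrite mule_ge0 ?riesz_ge0 ?chain_ge0.
rewrite /cyclic_integral /=.
apply: eq_integral => x1 _; rewrite chainS; apply: eq_integral => x2 _.
rewrite -step ?riesz_ge0//; apply: eq_integral => x3 _.
rewrite muleA -step ?mule_ge0 ?riesz_ge0//; apply: eq_integral => x4 _.
rewrite muleA -step ?mule_ge0 ?riesz_ge0//; apply: eq_integral => x5 _.
rewrite chain0 /riesz -!EFinM; congr EFin.
rewrite !big_ord_recl big_ord0 !(tnth_nth 0%R) /= mulr1 !mulrA.
by [].
Qed.

Lemma chain_cone n (l x y : R) : (0 < l)%R ->
  chain n l (l * x)%R (l * y)%R = (l `^ (n%:R - n.+1%:R * d))%:E * chain n 1 x y.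
Proof. by move=> l0; rewrite -chain_scale// mulr1. Qed.

(** Meant for homogeneous [f]; the formula is asked only for [l > 0] because the scaling laws need a
    positive factor. *)
Lemma integral_powRZ (p : R) (c : \bar R) (f : R -> \bar R) : (0 < p)%R ->
  0 <= c -> measurable_fun setT f ->
  (forall l, (0 < l)%R -> f l = (l `^ (p - 1))%:E * c) ->
  \int[mu]_(l in `[0%R, 1%R]) f l = p^-1%:E * c.
Proof.
move=> p0 c0 mf fE.
rewrite -integral_powR// -ge0_integralZr//; first last.
- by move=> x _; rewrite lee_fin powR_ge0.
- by apply: measurable_funTS; mfun.
rewrite -[LHS]integral_itv_obnd_cbnd; last exact: measurable_funTS.
rewrite -[RHS]integral_itv_obnd_cbnd; last first.
  by apply: measurable_funTS; mfun.
by apply: eq_integral => l; rewrite inE/= in_itv/= => /andP[l0 _]; rewrite fE.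
Qed.

Lemma cyclic_integral5_chain : (5 * d < 4)%R ->
  cyclic_integral d 5 = ((1 - d)^-1 * (2 / (4 - 5 * d)))%:E *
    (chain 3 1 0 1 + chain 1 1 0 1 * chain 2 1 0 1).
Proof.
move=> d45.
have C0 i : 0 <= chain i 1 0 1 by exact: chain_ge0.
rewrite cyclic_integral5 chain_trace.
(* [chain 4 l l l] is homogeneous of degree [4 - 5 d] in [l], so the factor 5 of the trace becomes
   [5 / (5 - 5 d) = 1 / (1 - d)]. *)
rewrite (@integral_powRZ (5 - 5 * d) (chain 4 1 1 1)); first last.
- move=> l l0; have := chain_cone 4 1 1 l0; rewrite mulr1 => ->.
  by rewrite (_ : 4 - 5 * d = 5 - 5 * d - 1)%R //; ring.
- exact: (@measurable_chain _ _ 4 _ _ (fun t => t) (fun t => t) (fun t => t)).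
- exact: chain_ge0.
- lra.
(* Reflection moves the base point from 1 to 0; cutting at the largest point [l] then leaves two
   chains between 0 and [l] inside [[0, l]]. *)
have := chain_refl d 4 1 0 0; rewrite subr0 => ->.
rewrite chain_split.
(* The degrees [i - (i + 1) d] and [(3 - i) - (4 - i) d] of the two halves add up to [3 - 5 d] for
   every [i]. *)
have step (i : 'I_4) :
    \int[mu]_(l in `[0%R, 1%R]) (chain i l 0 l * chain (3 - i) l l 0) =
    (4 - 5 * d)^-1%:E * (chain i 1 0 1 * chain (3 - i) 1 0 1).
  apply: integral_powRZ.
  - lra.
  - by rewrite mule_ge0.
  - apply: emeasurable_funM.
    + exact: (@measurable_chain _ _ i _ _ (fun t => t) (fun=> 0%R) (fun t => t)).
    + exact: (@measurable_chain _ _ (3 - i) _ _ (fun t => t) (fun t => t) (fun=> 0%R)).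
  - move=> l l0; rewrite (chainC _ _ _ l 0).
    have e j : chain j l 0 l = (l `^ (j%:R - j.+1%:R * d))%:E * chain j 1 0 1.
      by rewrite -chain_cone// mulr0 mulr1.
    rewrite !e muleACA -EFinM -powRD ?(gt_eqF l0) ?implybT//.
    congr (EFin (powR _ _) * _).
    rewrite -[(3 - i).+1%:R]natr1 -[i.+1%:R]natr1 natrB; last by rewrite -ltnS.
    by ring.
rewrite (eq_bigr _ (fun i _ => step i)) !big_ord_recl big_ord0 adde0 /=.
rewrite !/bump /= !subn0 !chain0 /riesz sub0r normrN normr1 powR1 mul1e mule1.
rewrite -[(1 + (1 + (1 + 0)))%N]/3%N -[(3 - (1 + 0))%N]/2%N.
rewrite -[(3 - (1 + (1 + 0)))%N]/1%N -[(1 + (1 + 0))%N]/2%N -[(1 + 0)%N]/1%N.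
rewrite (muleC (chain 2 1 0 1)).
set P := chain 3 1 0 1; set Q := chain 1 1 0 1 * chain 2 1 0 1.
have P0 : 0 <= P by exact: C0.
have Q0 : 0 <= Q := mule_ge0 (C0 1%N) (C0 2%N).
clearbody P Q; clear step C0.
rewrite -!ge0_muleDr ?adde_ge0//.
(* The four products [C_0 C_3], [C_1 C_2], [C_2 C_1], [C_3 C_0] pair up, which is the source of the
   factor 2. *)
have dbl (x y : \bar R) : x + (y + (y + x)) = 2%:R%:E * (x + y).
  by rewrite mule_natl mule2n -addeA; congr (_ + (_ + _)); exact: addeC.
rewrite dbl.
rewrite !muleA -!EFinM; congr (EFin _ * _); field.
by apply/and3P; split; apply/eqP; lra.
Qed.

End cumulant_chain.

(** * Chains from 0 to 1 with at most three intermediate points *)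

Section chain_values.
Local Open Scope ereal_scope.
Context (R : realType) (d : R).
Local Notation mu := (@lebesgue_measure R).
Local Notation chain := (chain d).
Local Notation riesz := (riesz d).

(** For [s > 0] this is, up to the factor [Gamma s], the Riemann-Liouville fractional integral of
    order [s] of [(1 - w)^(-d)]. *)
Definition tailI (s v : R) : \bar R :=
  \int[mu]_(w in `[0%R, v]) ((v - w) `^ (s - 1) * (1 - w) `^ (- d))%:E.

Definition powtailI (p s : R) : \bar R :=
  \int[mu]_(v in `[0%R, 1%R]) ((v `^ (p - 1))%:E * tailI s v).

Lemma powR2_ge0 (x y a b : R) : 0 <= (x `^ a * y `^ b)%:E.
Proof. by rewrite lee_fin mulr_ge0 ?powR_ge0. Qed.

Lemma tailI_ge0 s v : 0 <= tailI s v.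
Proof. by apply: integral_ge0 => w _; exact: powR2_ge0. Qed.

Lemma measurable_tailI s e (T : measurableType e) (f : T -> R) :
  measurable_fun setT f -> measurable_fun setT (fun t => tailI s (f t)).
Proof.
move=> mf; apply: measurable_integral_itv => //.
- by mfun.
- by move=> t x; exact: powR2_ge0.
Qed.

Ltac mtail := repeat first [mfun1 | match goal with
  | |- measurable_fun _ (fun t => tailI _ _) => apply: measurable_tailI
  | |- measurable_fun _ (tailI ?s) => apply: (@measurable_tailI s _ _ (fun t => t))
  end].

Lemma powtailI_ge0 p s : 0 <= powtailI p s.
Proof.
by apply: integral_ge0 => v _; rewrite mule_ge0 ?tailI_ge0// lee_fin powR_ge0.
Qed.

Lemma integral_two_powR (a b u v : R) : (u < v)%R ->
  \int[mu]_(x in `[u, v]) ((v - x) `^ (b - 1) * (x - u) `^ (a - 1))%:E =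
  ((v - u) `^ (a + b - 1))%:E * betaI a b.
Proof.
rewrite -subr_gt0 => uv; rewrite -(betaI_scale a b uv).
have := @ge0_integral_itv_shift R u 0 (v - u)
  (fun x => ((v - x) `^ (b - 1) * (x - u) `^ (a - 1))%:E).
rewrite add0r subrK => ->; first last.
- by move=> x; exact: powR2_ge0.
- by mfun.
by apply: eq_integral => x _; rewrite addrK mulrC (_ : v - (x + u) = v - u - x)%R//; ring.
Qed.

(** The semigroup law of fractional integration: after the exchange, the integral over [b] in
    [[w, v]] is a Beta integral scaled by [(v - w)^(s + r - 1)]. *)
Lemma tailI_conv r s v :
  \int[mu]_(b in `[0%R, v]) (((v - b) `^ (r - 1))%:E * tailI s b) =
  betaI s r * tailI (s + r) v.
Proof.
pose g b w : \bar R :=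
  ((v - b) `^ (r - 1) * (b - w) `^ (s - 1) * (1 - w) `^ (- d))%:E.
have g0 b w : 0 <= g b w by rewrite lee_fin !mulr_ge0 ?powR_ge0.
transitivity (\int[mu]_(b in `[0%R, v]) \int[mu]_(w in `[0%R, b]) g b w).
  apply: eq_integral => b _; rewrite -ge0_itv_integralZl.
  - by apply: eq_integral => w _; rewrite -EFinM mulrA.
  - by rewrite lee_fin powR_ge0.
  - by mfun.
  - by move=> w; exact: powR2_ge0.
rewrite tonelli_triangle//; last by rewrite /g; mfun.
rewrite -ge0_itv_integralZl; first last.
- by move=> w; exact: powR2_ge0.
- by mfun.
- exact: betaI_ge0.
rewrite -[LHS]integral_itv_bndo_bndc; last first.
  apply: measurable_funTS; apply: (@measurable_integral_itv R _ _ (fun t => t) (fun=> v)) => //.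
  by rewrite /g; mfun.
rewrite -[RHS]integral_itv_bndo_bndc; last first.
  by apply: measurable_funTS; apply: emeasurable_funM => //; mfun.
apply: eq_integral => w; rewrite inE/= in_itv/= => /andP[_ wv].
rewrite EFinM muleA [betaI _ _ * _]muleC -integral_two_powR//.
rewrite -ge0_integralZr//; first last.
- by rewrite lee_fin powR_ge0.
- by move=> b _; exact: powR2_ge0.
- by apply: measurable_funTS; mfun.
Qed.

Lemma tailI_refl s b :
  tailI s (1 - b) =
  \int[mu]_(v in `[b, 1%R]) ((v - b) `^ (s - 1) * v `^ (- d))%:E.
Proof.
rewrite [RHS](ge0_integral_itv_refl 1); first last.
- by move=> x; exact: powR2_ge0.
- by mfun.
rewrite subrr; apply: eq_integral => w _.
by rewrite (_ : 1 - w - b = 1 - b - w)%R//; ring.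
Qed.

(** By [tailI_refl] the first factor is an integral over [v] in [[b, 1]]. After the exchange the
    integral over [b] is that of [tailI_conv], and the remaining weight [v^(-d)] is [v^(p - 1)] for
    [p = 1 - d]. *)
Lemma integral_tailI_tailI r s :
  \int[mu]_(b in `[0%R, 1%R]) (tailI r (1 - b) * tailI s b) =
  betaI s r * powtailI (1 - d) (s + r).
Proof.
pose g b v : \bar R := ((v - b) `^ (r - 1) * v `^ (- d))%:E * tailI s b.
have g0 b v : 0 <= g b v by rewrite mule_ge0 ?powR2_ge0 ?tailI_ge0.
transitivity (\int[mu]_(b in `[0%R, 1%R]) \int[mu]_(v in `[b, 1%R]) g b v).
  apply: eq_integral => b _; rewrite tailI_refl -ge0_integralZr//.
  - by apply: measurable_funTS; mfun.
  - by move=> v _; exact: powR2_ge0.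
  - exact: tailI_ge0.
have := @tonelli_triangle R 0 1 (fun v b => g b v).
have mg : measurable_fun setT (fun z : R * R => g z.2 z.1) by rewrite /g; mtail.
move=> /(_ mg (fun v b => g0 b v)) <-.
rewrite -ge0_itv_integralZl; first last.
- by move=> v; rewrite mule_ge0 ?tailI_ge0// lee_fin powR_ge0.
- by mtail.
- exact: betaI_ge0.
apply: eq_integral => v _; rewrite muleCA -tailI_conv -ge0_itv_integralZl; first last.
- by move=> b; rewrite mule_ge0 ?tailI_ge0// lee_fin powR_ge0.
- by mtail.
- by rewrite lee_fin powR_ge0.
apply: eq_integral => b _; rewrite muleA -EFinM /g mulrC.
by rewrite (_ : 1 - d - 1 = - d)%R//; ring.
Qed.

Let s := (1 - d)%R.
Let B := betaI s s.

Lemma betaI_ss_ge0 : 0 <= B. Proof. exact: betaI_ge0. Qed.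

(** Cut at [b]: the intermediate points left of [b] give a Beta integral rescaled to [[0, b]], those
    right of [b] give the tail. *)
Lemma chain1_decomp (b : R) : (0 < b <= 1)%R ->
  chain 1 1 0 b = (b `^ (s + s - 1))%:E * B + tailI s (1 - b).
Proof.
move=> /andP[b0 b1]; rewrite chainS (@ge0_integral_itv_split R b); first last.
- by rewrite b1 ltW.
- by move=> z; rewrite mule_ge0 ?riesz_ge0 ?chain_ge0.
- exact: measurable_riesz_chain.
have sd : (s - 1 = - d)%R by rewrite /s; ring.
apply: f_equal2.
  rewrite -(betaI_scale s s b0); apply: eq_integral => x; rewrite inE/= in_itv/= => /andP[x0 xb].
  rewrite chain0 /riesz -EFinM sd sub0r normrN (ger0_norm x0) distrC.
  by rewrite ger0_norm ?subr_ge0.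
rewrite tailI_refl; apply: eq_integral => x; rewrite inE/= in_itv/= => /andP[bx x1].
rewrite chain0 /riesz -EFinM sd sub0r normrN ger0_norm ?(le_trans _ bx) ?(ltW b0)//.
by rewrite ger0_norm ?subr_ge0// mulrC.
Qed.

Lemma chain1E : chain 1 1 0 1 = B.
Proof.
have sd : (s - 1 = - d)%R by rewrite /s; ring.
rewrite chainS /B /betaI; apply: eq_integral => x; rewrite inE/= in_itv/= => /andP[x0 x1].
rewrite chain0 /riesz -EFinM sd sub0r normrN (ger0_norm x0) distrC.
by rewrite ger0_norm ?subr_ge0.
Qed.

Lemma chain1_1 z : chain 1 1 z 1 = chain 1 1 0 (1 - z).
Proof. by rewrite chainC -(chain_refl _ _ 1 1 z) subrr. Qed.

(** By [chain1_decomp] this is [chain 1 1 0 z] for [0 < z <= 1]. *)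
Let K z : \bar R := (z `^ (s + s - 1))%:E * B + tailI s (1 - z).

Let K_ge0 z : 0 <= K z.
Proof.
by rewrite adde_ge0 ?tailI_ge0// mule_ge0 ?betaI_ss_ge0// lee_fin powR_ge0.
Qed.

Let measurable_K e (T : measurableType e) (f : T -> R) :
  measurable_fun setT f -> measurable_fun setT (fun t => K (f t)).
Proof. by move=> mf; rewrite /K; mtail. Qed.

Ltac pos := repeat match goal with
  | |- is_true (@Order.le _ _ _ (tailI _ _)) => exact: tailI_ge0
  | |- is_true (@Order.le _ _ _ (betaI _ _)) => exact: betaI_ge0
  | |- is_true (@Order.le _ _ _ B) => exact: betaI_ge0
  | |- is_true (@Order.le _ _ _ (K _)) => exact: K_ge0
  | |- is_true (@Order.le _ _ _ (EFin (@GRing.mul _ _ _))) => exact: powR2_ge0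
  | |- is_true (@Order.le _ _ _ (EFin _)) => rewrite lee_fin; exact: powR_ge0
  | |- is_true (@Order.le _ _ _ (mule _ _)) => apply: mule_ge0
  | |- is_true (@Order.le _ _ _ (@GRing.add _ _ _)) => apply: adde_ge0
  end.

Ltac meas := repeat first [mfun1 | match goal with
  | |- measurable_fun _ (fun t => tailI _ _) => apply: measurable_tailI
  | |- measurable_fun _ (tailI ?s) => apply: (@measurable_tailI s _ _ (fun t => t))
  | |- measurable_fun _ (fun t => K _) => apply: measurable_K
  | |- measurable_fun _ K => apply: (@measurable_K _ _ (fun t => t))
  end].

Ltac side := lazymatch goal with
  | |- measurable_fun setT _ => by meas
  | |- measurable_fun _ _ => by apply: measurable_funTS; meas
  | |- forall x, _ -> is_true _ => by move=> ? _; pos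
  | |- forall x, is_true _ => by move=> ?; pos
  | |- is_true _ => by pos
  | |- measurable _ => exact: measurable_itv
  end.

Lemma integral_powR_K (p : R) :
  \int[mu]_(z in `[0%R, 1%R]) ((z `^ (p - 1))%:E * K (1 - z)) =
  B * betaI p (s + s) + powtailI p s.
Proof.
under eq_integral => z _.
  rewrite /K subKr ge0_muleDr; try side.
  rewrite muleA -EFinM; over.
rewrite ge0_integralD; try side.
apply: f_equal2 => //; rewrite ge0_integralZr; try side.
by rewrite muleC.
Qed.

(** Cut at the first intermediate point [z]: its kernel is [z^(s - 1)], and the rest of the chain,
    reflected, is [K (1 - z)]. *)
Lemma chain2E : chain 2 1 0 1 = B * betaI s (s + s) + powtailI s s.
Proof.
have sd : (s - 1 = - d)%R by rewrite /s; ring.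
rewrite -integral_powR_K chainS.
rewrite -[LHS]integral_itv_bndo_bndc; last first.
  by apply: measurable_funTS; exact: measurable_riesz_chain.
rewrite -[RHS]integral_itv_bndo_bndc; try side.
apply: eq_integral => z; rewrite inE/= in_itv/= => /andP[z0 z1].
rewrite chain1_1 chain1_decomp ?subr_gt0 ?z1 ?gerBl//.
by rewrite /riesz sub0r normrN ger0_norm// sd.
Qed.

(** Cut at the second of the three points: the halves are [K z] and [K (1 - z)]. Of the four
    products, the two mixed ones agree under [z -> 1 - z], so [powtailI (s + s) s] occurs twice; the
    product of the tails is [integral_tailI_tailI]. *)
Lemma chain3E :
  chain 3 1 0 1 = B * (B * betaI (s + s) (s + s) + powtailI (s + s) s)
    + (B * powtailI (s + s) s + B * powtailI s (s + s)).
Proof.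
rewrite -(chain_comp d 1 1).
transitivity (\int[mu]_(z in `[0%R, 1%R]) (K z * K (1 - z))).
  rewrite (integral_itv_bndoo true false); last first.
    apply: measurable_funTS; apply: emeasurable_funM.
    - exact: (@measurable_chain _ _ 1 _ _ (fun=> 1%R) (fun=> 0%R) (fun t => t)).
    - exact: (@measurable_chain _ _ 1 _ _ (fun=> 1%R) (fun t => t) (fun=> 1%R)).
  rewrite (integral_itv_bndoo true false); try side.
  apply: eq_integral => z; rewrite inE/= in_itv/= => /andP[z0 z1].
  rewrite chain1_1 !chain1_decomp//.
  - by rewrite subr_gt0 z1 gerBl ltW.
  - by rewrite z0 ltW.
under eq_integral => z _.
  rewrite {1}/K ge0_muleDl; try side.
  rewrite muleAC muleC; over.
rewrite ge0_integralD; try side.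
rewrite ge0_itv_integralZl; try side.
apply: f_equal2; first by rewrite integral_powR_K.
under eq_integral => z _.
  rewrite /K subKr ge0_muleDr; try side.
  over.
rewrite ge0_integralD; try side.
apply: f_equal2; last exact: integral_tailI_tailI.
rewrite (ge0_integral_itv_refl 1); try side.
rewrite subrr subr0 -ge0_itv_integralZl; try side.
by apply: eq_integral => z _; rewrite subKr muleA muleC [tailI _ _ * _]muleC.
Qed.

End chain_values.

(** * Binomial series and hypergeometric values *)

Section hypergeometric.
Local Open Scope ereal_scope.
Context (R : realType).
Local Notation mu := (@lebesgue_measure R).

Lemma limn_nneseries (u : R^nat) : (forall n, (0 <= u n)%R) ->
  cvgn (series u) -> \sum_(n <oo) (u n)%:E = (limn (series u))%:E.
Proof.
move=> u0 cu; rewrite -EFin_lim//; congr (limn _); apply/funext => n /=.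
by rewrite /series/= sumEFin.
Qed.

(** [hyper3F2] is a [limn], meaningful only for a convergent series; a finite sum in [\bar R]
    supplies the convergence. *)
Lemma nneseries_limn (u : R^nat) (l : R) : (forall n, (0 <= u n)%R) ->
  \sum_(n <oo) (u n)%:E = l%:E -> limn (series u) = l.
Proof.
move=> u0 ul.
have cu : (fun n => \sum_(0 <= i < n) (u i)%:E) @ \oo --> l%:E.
  rewrite -ul; apply: is_cvg_nneseries => n _ _; exact: u0.
apply: cvg_lim => //.
have e : (fun n => \sum_(0 <= i < n) (u i)%:E) = EFin \o series u.
  by apply/funext => n /=; rewrite /series/= sumEFin.
by move: cu; rewrite e => /fine_cvgP[].
Qed.

Lemma pochhammer0 (a : R) : pochhammer a 0 = 1%R.
Proof. by rewrite /pochhammer big_ord0. Qed.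

Lemma pochhammerS (a : R) n : pochhammer a n.+1 = (pochhammer a n * (a + n%:R))%R.
Proof. by rewrite /pochhammer big_ord_recr. Qed.

Lemma pochhammerSl (a : R) n : pochhammer a n.+1 = (a * pochhammer (a + 1) n)%R.
Proof.
rewrite /pochhammer big_ord_recl addr0; congr (_ * _)%R.
by apply: eq_bigr => i _; rewrite lift0 -natr1; ring.
Qed.

Lemma pochhammer_gt0 (a : R) n : (0 < a)%R -> (0 < pochhammer a n)%R.
Proof. by move=> a0; apply: prodr_gt0 => i _; rewrite ltr_wpDr. Qed.

Lemma pochhammer_ge0 (a : R) n : (0 <= a)%R -> (0 <= pochhammer a n)%R.
Proof. by move=> a0; apply: prodr_ge0 => i _; rewrite addr_ge0. Qed.

Lemma pochhammer1 n : pochhammer (1 : R) n = n`!%:R.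
Proof.
elim: n => [|n IH]; first by rewrite pochhammer0.
by rewrite pochhammerS IH factS natrM mulrC nat1r.
Qed.

Lemma Gamma_pochhammer (a : R) n : (0 < a)%R ->
  Gamma (a + n%:R) = (pochhammer a n * Gamma a)%R.
Proof.
move=> a0; elim: n => [|n IH]; first by rewrite addr0 pochhammer0 mul1r.
have -> : (a + n.+1%:R = (a + n%:R) + 1)%R by rewrite -natr1 addrA.
have an0 : (0 < a + n%:R)%R by rewrite ltr_wpDr.
by rewrite (Gamma_recur an0) IH pochhammerS mulrA (mulrC (a + n%:R)%R).
Qed.

(** The Taylor coefficient of [(1 - x)^(-d)] at 0; its sign for [d >= 0] justifies the termwise
    integrations. *)
Definition binom_coef (d : R) (n : nat) : R := (pochhammer d n / n`!%:R)%R.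

Lemma binom_coef_ge0 d n : (0 <= d)%R -> (0 <= binom_coef d n)%R.
Proof. by move=> d0; rewrite divr_ge0 ?pochhammer_ge0. Qed.

Lemma gammaI_laplace (a c : R) : (0 < c)%R ->
  \int[mu]_(s in `]0%R, +oo[) (s `^ (a - 1) * expR (- (c * s)))%:E =
  (c `^ (- a))%:E * gammaI a.
Proof.
move=> c0; have cn0 : c != 0%R by rewrite gt_eqF.
have mf : measurable_fun setT (fun s : R => (s `^ (a - 1) * expR (- s))%:E).
  by mfun.
rewrite /gammaI [in RHS]integral_mkcond (@ge0_integral_affine R c 0)//; first last.
- by move=> x; rewrite /patch; case: ifP => // _; rewrite lee_fin mulr_ge0 ?powR_ge0 ?expR_ge0.
- by apply/(measurable_restrictT _ _).1 => //; exact: measurable_funTS.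
rewrite muleA -EFinM integral_mkcond.
rewrite -ge0_integralZl//; first last.
- by rewrite lee_fin mulr_ge0 ?powR_ge0// ltW.
- by move=> x _; rewrite /patch; case: ifP => // _; rewrite lee_fin mulr_ge0 ?powR_ge0 ?expR_ge0.
- have mg : measurable_fun setT (fun x : R => (c * x + 0)%R) by mfun.
  apply: (measurableT_comp _ mg).
  by apply/(measurable_restrictT _ _).1 => //; exact: measurable_funTS.
apply: eq_integral => s _; rewrite /patch !mem_setE addr0 !in_itv/= !andbT.
rewrite pmulr_rgt0//; case: ifPn => [s0|_]; last by rewrite mule0.
rewrite -EFinM powRM ?(ltW c0) ?(ltW s0)//; congr EFin.
have -> : (c `^ (- a) * c * (c `^ (a - 1) * s `^ (a - 1) * expR (- (c * s))) =
  (c `^ (- a) * c `^ 1 * c `^ (a - 1)) * (s `^ (a - 1) * expR (- (c * s))))%R.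
  by rewrite powRr1 ?(ltW c0)//; ring.
rewrite -!powRD ?cn0 ?implybT//.
by rewrite (_ : - a + 1 + (a - 1) = 0)%R ?powRr0 ?mul1r//; ring.
Qed.

(* For [0 < d] expand [exp (x s)] in the Gamma integral of [(1 - x)^(-d)]. *)
Lemma binomial_series (d x : R) : (0 <= d)%R -> (0 <= x < 1)%R ->
  ((1 - x) `^ (- d))%:E = \sum_(n <oo) (binom_coef d n * x ^+ n)%:E.
Proof.
(* The Gamma integral of exponent [d] calls for [d > 0]; for [d = 0] only the constant term of the
   series survives. *)
rewrite le_eqVlt => /predU1P[<-|d0] /andP[x0 x1].
  rewrite oppr0 powRr0 nneseries_recl//; last first.
    by move=> k; rewrite lee_fin mulr_ge0 ?exprn_ge0 ?binom_coef_ge0.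
  rewrite /binom_coef pochhammer0 expr0 fact0 invr1 !mulr1.
  rewrite eseries0 ?adde0// => -[//|n] _ _.
  by rewrite pochhammerSl !mul0r.
have G0 := Gamma_gt0 d0.
suff : ((1 - x) `^ (- d))%:E * gammaI d =
    (\sum_(n <oo) (binom_coef d n * x ^+ n)%:E) * gammaI d.
  rewrite gammaI_Gamma// => /(congr1 (fun z => z * (Gamma d)^-1%:E)).
  have e : (Gamma d)%:E * (Gamma d)^-1%:E = 1 by rewrite -EFinM mulfV ?gt_eqF.
  by rewrite -!muleA e !mule1.
rewrite -gammaI_laplace ?subr_gt0// gammaI_Gamma// [RHS]muleC -nneseriesZl; last first.
  by move=> i _; rewrite lee_fin mulr_ge0 ?exprn_ge0 ?binom_coef_ge0// ltW.
transitivity (\int[mu]_(s in `]0%R, +oo[)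
    \sum_(n <oo) (s `^ (d - 1) * expR (- s) * exp_coeff (x * s) n)%:E).
  apply: eq_integral => s; rewrite inE/= in_itv/= andbT => s0.
  under eq_eseriesr do rewrite EFinM.
  rewrite nneseriesZl; last first.
    by move=> i _; rewrite lee_fin exp_coeff_ge0// mulr_ge0// ltW.
  rewrite limn_nneseries; last exact: is_cvg_series_exp_coeff.
    rewrite -EFinM -mulrA -[limn _]/(expR (x * s)) -expRD; congr (_ * expR _)%:E.
    by ring.
  by move=> i; rewrite exp_coeff_ge0// mulr_ge0// ltW.
rewrite integral_nneseries//; first last.
- move=> n s /=; rewrite in_itv/= andbT => s0.
  rewrite lee_fin; apply: mulr_ge0; first by rewrite mulr_ge0 ?powR_ge0 ?expR_ge0.
  by rewrite exp_coeff_ge0// mulr_ge0// ltW.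
- move=> n; apply: measurable_funTS; rewrite /exp_coeff/=; mfun; exact: mulrl_measurable.
apply: eq_eseriesr => n _.
transitivity (\int[mu]_(s in `]0%R, +oo[)
    ((x ^+ n / n`!%:R)%:E * (s `^ (d + n%:R - 1) * expR (- s))%:E)).
  apply: eq_integral => s; rewrite inE/= in_itv/= andbT => s0.
  rewrite -EFinM /exp_coeff/= exprMn; congr EFin.
  rewrite (_ : d + n%:R - 1 = (d - 1) + n%:R)%R; last by ring.
  rewrite (@powRD _ s (d - 1) n%:R) ?(gt_eqF s0) ?implybT// powR_mulrn ?(ltW s0)//.
  by ring.
rewrite ge0_integralZl//; first last.
- by rewrite lee_fin divr_ge0 ?exprn_ge0.
- by move=> s _; rewrite lee_fin mulr_ge0 ?powR_ge0 ?expR_ge0.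
- by apply: measurable_funTS; mfun.
(* The [n]-th moment is [Gamma(d + n) = (d)_n Gamma(d)], which produces the binomial coefficient. *)
rewrite -/(gammaI _) gammaI_Gamma ?ltr_wpDr// Gamma_pochhammer//.
by rewrite -!EFinM /binom_coef; congr EFin; ring.
Qed.

End hypergeometric.

(** * Double integrals as values of 3F2 at 1 *)

Section hypergeometric_integrals.
Local Open Scope ereal_scope.
Context (R : realType).
Local Notation mu := (@lebesgue_measure R).

(* [w `^ n%:R] instead of [w ^+ n] keeps the integrand nonnegative for [w < 0]. *)
Lemma integral_binomial_series (d : R) (g : R -> R -> R) : (0 <= d)%R ->
  (forall v w, (0 <= g v w)%R) ->
  measurable_fun setT (fun z : R * R => g z.1 z.2) ->
  \int[mu]_(v in `[0%R, 1%R]) \int[mu]_(w in `[0%R, v])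
    (g v w * (1 - w) `^ (- d))%:E =
  \sum_(n <oo) (binom_coef d n)%:E *
    \int[mu]_(v in `[0%R, 1%R]) \int[mu]_(w in `[0%R, v])
      (g v w * w `^ n%:R)%:E.
Proof.
move=> d0 g0 mg.
have mgv v : measurable_fun setT (g v).
  apply: (measurableT_comp mg (_ : measurable_fun setT (fun w => (v, w)))).
  by mfun.
have b0 n : 0 <= (binom_coef d n)%:E by rewrite lee_fin binom_coef_ge0.
have gn0 n v w : 0 <= (g v w * w `^ n%:R)%:E by rewrite lee_fin mulr_ge0 ?powR_ge0.
have mgn n : measurable_fun setT (fun z : R * R => (g z.1 z.2 * z.2 `^ n%:R)%:E).
  by mfun.
pose G n v := \int[mu]_(w in `[0%R, v]) (g v w * w `^ n%:R)%:E.
have mG n : measurable_fun setT (G n).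
  by apply: (@measurable_integral_itv R _ _ (fun=> 0%R) (fun t => t)).
have G0 n v : 0 <= G n v by exact: integral_ge0.
(* Dropping [v = 1] keeps [w <= v < 1] where the binomial series is available. *)
rewrite -[LHS]integral_itv_bndo_bndc; last first.
  apply: measurable_funTS; apply: (@measurable_integral_itv R _ _ (fun=> 0%R) (fun t => t)) => //.
    by mfun.
  by move=> v w; rewrite lee_fin mulr_ge0 ?powR_ge0.
transitivity (\int[mu]_(v in `[0%R, 1%R[) \sum_(n <oo) (binom_coef d n)%:E * G n v).
  apply: eq_integral => v; rewrite inE/= in_itv/= => /andP[v0 v1].
  have {}mgv := mgv v.
  transitivity (\int[mu]_(w in `[0%R, v]) \sum_(n <oo)
      (binom_coef d n)%:E * (g v w * w `^ n%:R)%:E).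
    apply: eq_integral => w; rewrite inE/= in_itv/= => /andP[w0 wv].
    rewrite EFinM binomial_series//; last by rewrite w0 (le_lt_trans wv).
    rewrite -nneseriesZl; last first.
      by move=> n _; rewrite lee_fin mulr_ge0 ?exprn_ge0 ?binom_coef_ge0.
    apply: eq_eseriesr => n _; rewrite powR_mulrn// -!EFinM; congr EFin; ring.
  rewrite integral_nneseries//.
  - apply: eq_eseriesr => n _; rewrite ge0_itv_integralZl//.
    by mfun.
  - by move=> n; apply: measurable_funTS; mfun.
  - by move=> n w _; rewrite mule_ge0.
rewrite integral_nneseries//; first last.
- by move=> n v _; rewrite mule_ge0.
- by move=> n; apply: measurable_funTS; have mGn := mG n; mfun.
apply: eq_eseriesr => n _.
rewrite integral_itv_bndo_bndc ?ge0_itv_integralZl//.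
by apply: measurable_funTS; have mGn := mG n; mfun.
Qed.

Lemma integral_powR_powR (a c v : R) : (0 < v)%R ->
  \int[mu]_(w in `[0%R, v]) (w `^ (a - 1) * w `^ c)%:E =
  (v `^ (a + c))%:E * betaI (a + c) 1.
Proof.
move=> v0; have := betaI_scale (a + c) 1 v0; rewrite addrK => <-.
rewrite -[LHS]integral_itv_obnd_cbnd; last by apply: measurable_funTS; mfun.
rewrite -[RHS]integral_itv_obnd_cbnd; last by apply: measurable_funTS; mfun.
apply: eq_integral => w; rewrite inE/= in_itv/= => /andP[w0 _].
rewrite subrr powRr0 mulr1 -powRD ?(gt_eqF w0) ?implybT//.
by rewrite (_ : a - 1 + c = a + c - 1)%R//; ring.
Qed.

(** The integral of [(v - w)^(s - 1) w^n] over [w] is [v^(n + s)] times a Beta value; the remaining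
    power of [v] integrates to [1 / (p + s + n)]. *)
Lemma powtailI_series (d p s : R) : (0 <= d)%R -> (0 < p)%R -> (0 < s)%R ->
  powtailI d p s =
  \sum_(n <oo) (binom_coef d n)%:E * ((p + s + n%:R)^-1%:E * betaI n.+1%:R s).
Proof.
move=> d0 p0 s0.
pose g v w : R := (v `^ (p - 1) * (v - w) `^ (s - 1))%R.
have g0 v w : (0 <= g v w)%R by rewrite mulr_ge0 ?powR_ge0.
have mg : measurable_fun setT (fun z : R * R => g z.1 z.2) by rewrite /g; mfun.
transitivity (\int[mu]_(v in `[0%R, 1%R]) \int[mu]_(w in `[0%R, v])
    (g v w * (1 - w) `^ (- d))%:E).
  apply: eq_integral => v _; rewrite -ge0_itv_integralZl.
  - by apply: eq_integral => w _; rewrite -EFinM mulrA.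
  - by rewrite lee_fin powR_ge0.
  - by mfun.
  - by move=> w; exact: powR2_ge0.
rewrite integral_binomial_series//; apply: eq_eseriesr => n _; congr (_ * _).
apply: integral_powRZ.
- by rewrite ltr_wpDr// addr_gt0.
- exact: betaI_ge0.
- apply: (@measurable_integral_itv R _ _ (fun=> 0%R) (fun t => t)) => //.
    by rewrite /g; mfun.
  by move=> v w; rewrite lee_fin mulr_ge0 ?powR_ge0.
- move=> v v0.
  have -> : (v `^ (p + s + n%:R - 1) = v `^ (p - 1) * v `^ (n.+1%:R + s - 1))%R.
    rewrite -powRD ?(gt_eqF v0) ?implybT//; congr (_ `^ _)%R.
    by rewrite -natr1; ring.
  rewrite EFinM -muleA -(betaI_scale n.+1%:R s v0) -ge0_itv_integralZl.
  + apply: eq_integral => w _; rewrite -EFinM /g; congr EFin.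
    by rewrite -natr1 addrK; ring.
  + by rewrite lee_fin powR_ge0.
  + by mfun.
  + by move=> w; exact: powR2_ge0.
Qed.

Lemma betaI_nat (s : R) n : (0 < s)%R ->
  betaI n.+1%:R s = (n`!%:R / (s * pochhammer (s + 1) n))%:E.
Proof.
move=> s0; rewrite betaIE//; congr EFin.
have G0 := Gamma_gt0 s0.
have G1 : Gamma (n.+1%:R : R) = n`!%:R.
  by apply: EFin_inj; rewrite -gammaI_Gamma// gammaI_nat.
have -> : (n.+1%:R + s = s + n.+1%:R)%R by rewrite addrC.
rewrite Gamma_pochhammer// pochhammerSl G1.
have P0 : (0 < pochhammer (s + 1) n)%R by rewrite pochhammer_gt0// addr_gt0.
move: (Gamma s) (pochhammer _ _) G0 P0 => G P G0 P0.
by field; rewrite !gt_eqF.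
Qed.

(** The terms are nonnegative, so finiteness of [x] amounts to convergence and excludes a junk value
    of [hyper3F2]. *)
Lemma hyper3F2_series (a b c e f K : R) (x : \bar R) :
  (0 <= a)%R -> (0 <= b)%R -> (0 <= c)%R -> (0 < e)%R -> (0 < f)%R ->
  (0 < K)%R -> x < +oo ->
  x = \sum_(n <oo) (K * (pochhammer a n * pochhammer b n * pochhammer c n
      / (pochhammer e n * pochhammer f n) / n`!%:R))%:E ->
  x = (K * hyper3F2 a b c e f 1)%:E.
Proof.
move=> a0 b0 c0 e0 f0 K0 xoo xE.
pose u n : R := (pochhammer a n * pochhammer b n * pochhammer c n
      / (pochhammer e n * pochhammer f n) * (1 ^+ n / n`!%:R))%R.
have u0 n : (0 <= u n)%R.
  rewrite /u expr1n; apply: mulr_ge0; last by rewrite mul1r invr_ge0.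
  by rewrite divr_ge0 ?mulr_ge0 ?pochhammer_ge0// ltW.
have xu : x = K%:E * \sum_(n <oo) (u n)%:E.
  rewrite xE -nneseriesZl; last by move=> n _; rewrite lee_fin.
  by apply: eq_eseriesr => n _; rewrite -EFinM /u expr1n mul1r.
have : 0 <= \sum_(n <oo) (u n)%:E by apply: nneseries_ge0 => n _ _; rewrite lee_fin.
have : \sum_(n <oo) (u n)%:E < +oo.
  by move: xoo; rewrite xu !ltey; apply: contraNN => /eqP ->; rewrite gt0_muley.
case E : (\sum_(n <oo) (u n)%:E) xu => [l| |] xu// _ _.
rewrite xu -EFinM; congr (_ * _)%:E.
by apply/esym; exact: (nneseries_limn u0 E).
Qed.

(** For [w <= v] and [d >= 0] one has [(1 - w)^(-d) <= (1 - v)^(-d)]. The bound serves to prove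
    [powtailI] finite. *)
Lemma tailI_le (d s v : R) : (0 <= d)%R -> (0 < v < 1)%R ->
  tailI d s v <= (v `^ s * (1 - v) `^ (- d))%:E * betaI 1 s.
Proof.
move=> d0 /andP[v0 v1].
have E := betaI_scale 1 s v0; rewrite (_ : 1 + s - 1 = s)%R in E; last by ring.
rewrite mulrC EFinM -muleA -E.
rewrite -ge0_itv_integralZl; first last.
- by move=> w; exact: powR2_ge0.
- by mfun.
- by rewrite lee_fin powR_ge0.
apply: ge0_le_integral => //.
- by move=> w _; exact: powR2_ge0.
- by apply: measurable_funTS; mfun.
- by apply: measurable_funTS; mfun.
- move=> w /=; rewrite in_itv/= => /andP[w0 wv].
  rewrite subrr powRr0 mul1r -EFinM lee_fin mulrC.
  have v1' : (0 < 1 - v)%R by rewrite subr_gt0.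
  have w1' : (0 < 1 - w)%R by rewrite subr_gt0 (le_lt_trans wv).
  rewrite ler_wpM2r ?powR_ge0// !powRN lef_pV2 ?posrE ?powR_gt0//.
  by rewrite ge0_ler_powR ?nnegrE ?(ltW v1') ?(ltW w1')// lerD2l lerN2.
Qed.

Lemma powtailI_lty (d p s : R) : (0 <= d)%R -> (d < 1)%R -> (0 < p)%R ->
  (0 < s)%R -> powtailI d p s < +oo.
Proof.
move=> d0 d1 p0 s0.
have ps0 : (0 < p + s)%R by rewrite addr_gt0.
have mt : measurable_fun setT (tailI d s).
  exact: (@measurable_tailI _ _ s _ _ (fun t => t)).
apply: (@le_lt_trans _ _ (betaI (p + s) (1 - d) * betaI 1 s)); last first.
  by rewrite !betaIE ?subr_gt0// -EFinM ltry.
have -> : betaI (p + s) (1 - d) * betaI 1 s = \int[mu]_(t in `[0%R, 1%R])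
    ((t `^ (p + s - 1) * (1 - t) `^ (1 - d - 1))%:E * betaI 1 s).
  rewrite [RHS]ge0_integralZr//.
  - by apply: measurable_funTS; mfun.
  - by move=> v _; exact: powR2_ge0.
  - exact: betaI_ge0.
rewrite /powtailI.
rewrite (integral_itv_bndoo true false); last by apply: measurable_funTS; mfun.
rewrite (integral_itv_bndoo true false); last first.
  by apply: measurable_funTS; mfun.
apply: ge0_le_integral; first exact: measurable_itv.
- by move=> v _; rewrite mule_ge0 ?tailI_ge0// lee_fin powR_ge0.
- by apply: measurable_funTS; mfun.
- by apply: measurable_funTS; mfun.
- move=> v /=; rewrite in_itv/= => v01; have /andP[v0 v1] := v01.
  apply: (@le_trans _ _ ((v `^ (p - 1))%:E *
      ((v `^ s * (1 - v) `^ (- d))%:E * betaI 1 s))).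
    by rewrite lee_wpmul2l ?tailI_le// lee_fin powR_ge0.
  have e1 : (p - 1 + s = p + s - 1)%R by ring.
  have e2 : (1 - d - 1 = - d)%R by ring.
  by rewrite muleA -EFinM mulrA -powRD ?(gt_eqF v0) ?implybT// e1 e2.
Qed.

Lemma powtailI_hyper3F2 (d p s : R) : (0 <= d)%R -> (d < 1)%R -> (0 < p)%R ->
  (0 < s)%R ->
  powtailI d p s =
  ((s * (p + s))^-1 * hyper3F2 1 d (p + s) (s + 1) (p + s + 1) 1)%:E.
Proof.
move=> d0 d1 p0 s0; have ps0 : (0 < p + s)%R by rewrite addr_gt0.
apply: hyper3F2_series => //.
- exact: ltW.
- by rewrite addr_gt0.
- by rewrite addr_gt0.
- by rewrite invr_gt0 mulr_gt0.
- exact: powtailI_lty.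
rewrite powtailI_series//; apply: eq_eseriesr => n _.
rewrite betaI_nat// -!EFinM /binom_coef pochhammer1; congr EFin.
(* Since [(a)_n (a + n) = a (a + 1)_n], the factor [1 / (p + s + n)] becomes a quotient of
   Pochhammer symbols. *)
have : (pochhammer (p + s) n * (p + s + n%:R) = (p + s) * pochhammer (p + s + 1) n)%R.
  by rewrite -pochhammerS pochhammerSl.
have n0 : (0 < p + s + n%:R)%R by rewrite ltr_wpDr.
have P1 : (0 < pochhammer (s + 1) n)%R by rewrite pochhammer_gt0// addr_gt0.
have P2 : (0 < pochhammer (p + s + 1) n)%R by rewrite pochhammer_gt0// addr_gt0.
have F0 : (n`!%:R != 0 :> R)%R by rewrite pnatr_eq0 -lt0n fact_gt0.
move: (pochhammer (p + s) n) (pochhammer (s + 1) n) (pochhammer (p + s + 1) n)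
  (pochhammer d n) n`!%:R P1 P2 F0 => A P Q D F P1 P2 F0 AQ.
have -> : A = ((p + s) * Q / (p + s + n%:R))%R.
  by rewrite -AQ mulfK// gt_eqF.
by field; rewrite F0 !gt_eqF.
Qed.

(** The incomplete Beta integral with parameters [r] and [1 - d]. *)
Definition incbetaI (r d t : R) : \bar R :=
  \int[mu]_(w in `[0%R, t]) (w `^ (r - 1) * (1 - w) `^ (- d))%:E.

Definition powincbetaI (r d a b : R) : \bar R :=
  \int[mu]_(t in `[0%R, 1%R])
    ((t `^ (a - 1) * (1 - t) `^ (b - 1))%:E * incbetaI r d t).

(** Termwise, the inner integral is [t^(r + n) / (r + n)] and the outer one is a complete Beta
    integral. *)
Lemma powincbetaI_series (r d a b : R) : (0 <= d)%R -> (0 < r)%R ->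
  powincbetaI r d a b =
  \sum_(n <oo) (binom_coef d n)%:E *
    ((r + n%:R)^-1%:E * betaI (a + r + n%:R) b).
Proof.
move=> d0 r0.
pose g t w : R := (t `^ (a - 1) * (1 - t) `^ (b - 1) * w `^ (r - 1))%R.
have g0 t w : (0 <= g t w)%R by rewrite !mulr_ge0 ?powR_ge0.
have mg : measurable_fun setT (fun z : R * R => g z.1 z.2) by rewrite /g; mfun.
transitivity (\int[mu]_(t in `[0%R, 1%R]) \int[mu]_(w in `[0%R, t])
    (g t w * (1 - w) `^ (- d))%:E).
  apply: eq_integral => t _; rewrite -ge0_itv_integralZl.
  - by apply: eq_integral => w _; rewrite -EFinM mulrA.
  - exact: powR2_ge0.
  - by mfun.
  - by move=> w; exact: powR2_ge0.
rewrite integral_binomial_series//; apply: eq_eseriesr => n _; congr (_ * _).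
have rn0 : (0 < r + n%:R)%R by rewrite ltr_wpDr.
rewrite -ge0_itv_integralZl; first last.
- by move=> t; exact: powR2_ge0.
- by mfun.
- by rewrite lee_fin invr_ge0 ltW.
rewrite -[LHS]integral_itv_obnd_cbnd; last first.
  apply: measurable_funTS.
  apply: (@measurable_integral_itv R _ _ (fun=> 0%R) (fun t => t)) => //.
    by rewrite /g; mfun.
  by move=> t w; rewrite lee_fin mulr_ge0 ?powR_ge0.
rewrite -[RHS]integral_itv_obnd_cbnd; last by apply: measurable_funTS; mfun.
apply: eq_integral => t; rewrite inE/= in_itv/= => /andP[t0 _].
transitivity ((t `^ (a - 1) * (1 - t) `^ (b - 1))%:E *
    ((t `^ (r + n%:R))%:E * betaI (r + n%:R) 1)).
  rewrite -integral_powR_powR// -ge0_itv_integralZl.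
  - by apply: eq_integral => w _; rewrite -EFinM mulrA.
  - exact: powR2_ge0.
  - by mfun.
  - by move=> w; exact: powR2_ge0.
rewrite betaI1// -!EFinM; congr EFin.
have -> : (t `^ (a + r + n%:R - 1) = t `^ (a - 1) * t `^ (r + n%:R))%R.
  rewrite -powRD ?(gt_eqF t0) ?implybT//; congr (_ `^ _)%R.
  by ring.
by ring.
Qed.

Lemma incbetaI_ge0 r d t : 0 <= incbetaI r d t.
Proof. by apply: integral_ge0 => w _; exact: powR2_ge0. Qed.

Lemma measurable_incbetaI r d e (T : measurableType e) (f : T -> R) :
  measurable_fun setT f -> measurable_fun setT (fun t => incbetaI r d (f t)).
Proof.
move=> mf; apply: measurable_integral_itv => //.
- by mfun.
- by move=> t x; exact: powR2_ge0.
Qed.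

Lemma powincbetaI_lty (r d a b : R) : (0 < r)%R -> (d < 1)%R -> (0 < a)%R ->
  (0 < b)%R -> powincbetaI r d a b < +oo.
Proof.
move=> r0 d1 a0 b0.
have mi : measurable_fun setT (incbetaI r d).
  exact: (@measurable_incbetaI r d _ _ (fun t => t)).
apply: (@le_lt_trans _ _ (betaI a b * betaI r (1 - d))); last first.
  by rewrite !betaIE ?subr_gt0// -EFinM ltry.
have -> : betaI a b * betaI r (1 - d) = \int[mu]_(t in `[0%R, 1%R])
    ((t `^ (a - 1) * (1 - t) `^ (b - 1))%:E * betaI r (1 - d)).
  rewrite [RHS]ge0_integralZr//.
  - by apply: measurable_funTS; mfun.
  - by move=> v _; exact: powR2_ge0.
  - exact: betaI_ge0.
rewrite /powincbetaI.
apply: ge0_le_integral; first exact: measurable_itv.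
- by move=> v _; rewrite mule_ge0 ?incbetaI_ge0// powR2_ge0.
- by apply: measurable_funTS; mfun.
- by apply: measurable_funTS; mfun.
- move=> t /=; rewrite in_itv/= => /andP[t0 t1].
  rewrite lee_wpmul2l ?powR2_ge0// /betaI (_ : 1 - d - 1 = - d)%R; last by ring.
  apply: ge0_subset_integral => //.
  + by apply: measurable_funTS; mfun.
  + by move=> w _; exact: powR2_ge0.
  + by move=> w /=; rewrite !in_itv/= => /andP[-> wt]; rewrite (le_trans wt).
Qed.

Lemma powincbetaI_hyper3F2 (r d a b : R) : (0 <= d)%R -> (d < 1)%R ->
  (0 < r)%R -> (0 < a)%R -> (0 < b)%R ->
  powincbetaI r d a b =
  (Gamma (a + r) * Gamma b / Gamma (a + r + b) / r
    * hyper3F2 d r (a + r) (r + 1) (a + r + b) 1)%:E.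
Proof.
move=> d0 d1 r0 a0 b0.
have ar0 : (0 < a + r)%R by rewrite addr_gt0.
have arb0 : (0 < a + r + b)%R by rewrite addr_gt0.
have G1 := Gamma_gt0 ar0; have G2 := Gamma_gt0 b0; have G3 := Gamma_gt0 arb0.
apply: hyper3F2_series => //.
- exact: ltW.
- exact: ltW.
- by rewrite addr_gt0.
- by rewrite !divr_gt0// mulr_gt0.
- exact: powincbetaI_lty.
rewrite powincbetaI_series//; apply: eq_eseriesr => n _.
rewrite betaIE//; last by rewrite ltr_wpDr.
have -> : (a + r + n%:R + b = a + r + b + n%:R)%R by ring.
rewrite !Gamma_pochhammer// -!EFinM /binom_coef; congr EFin.
have : (pochhammer r n * (r + n%:R) = r * pochhammer (r + 1) n)%R.
  by rewrite -pochhammerS pochhammerSl.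
have n0 : (0 < r + n%:R)%R by rewrite ltr_wpDr.
have P1 : (0 < pochhammer (r + 1) n)%R by rewrite pochhammer_gt0// addr_gt0.
have P2 : (0 < pochhammer (a + r + b) n)%R by rewrite pochhammer_gt0.
have F0 : (n`!%:R != 0 :> R)%R by rewrite pnatr_eq0 -lt0n fact_gt0.
move: (pochhammer r n) (pochhammer (r + 1) n) (pochhammer (a + r + b) n)
  (pochhammer (a + r) n) (pochhammer d n) n`!%:R (Gamma (a + r)) (Gamma b)
  (Gamma (a + r + b)) P1 P2 F0 G1 G2 G3
  => A P Q V D F X Y Z P1 P2 F0 G1 G2 G3 AQ.
have -> : A = (r * P / (r + n%:R))%R by rewrite -AQ mulfK// gt_eqF.
by field; rewrite F0 !gt_eqF.
Qed.

Lemma incbetaI_refl (d t : R) : (0 <= t <= 1)%R ->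
  incbetaI (1 - d) d t + incbetaI (1 - d) d (1 - t) = betaI (1 - d) (1 - d).
Proof.
move=> /andP[t0 t1].
have e : (1 - d - 1 = - d)%R by ring.
rewrite /betaI (@ge0_integral_itv_split R t); first last.
- by rewrite t0.
- by move=> x; exact: powR2_ge0.
- by mfun.
rewrite /incbetaI !e; apply: f_equal2 => //.
rewrite [RHS](ge0_integral_itv_refl 1); first last.
- by move=> x; exact: powR2_ge0.
- by mfun.
by rewrite subrr; apply: eq_integral => w _; rewrite subKr mulrC.
Qed.

(** The substitution [t -> 1 - t] in the second integral swaps [a] and [b] back and reflects the
    incomplete Beta integral; by [incbetaI_refl] the two then add up to a constant under the
    integral. Thus two 3F2 values have an elementary combination. *)
Lemma powincbetaI_add (d a b : R) :
  powincbetaI (1 - d) d a b + powincbetaI (1 - d) d b a =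
  betaI (1 - d) (1 - d) * betaI a b.
Proof.
have mi : measurable_fun setT (incbetaI (1 - d) d).
  exact: (@measurable_incbetaI (1 - d) d _ _ (fun t => t)).
have -> : powincbetaI (1 - d) d b a = \int[mu]_(t in `[0%R, 1%R])
    ((t `^ (a - 1) * (1 - t) `^ (b - 1))%:E * incbetaI (1 - d) d (1 - t)).
  rewrite /powincbetaI [LHS](ge0_integral_itv_refl 1); first last.
  - by move=> x; rewrite mule_ge0 ?incbetaI_ge0 ?powR2_ge0.
  - by mfun.
  rewrite subrr subr0; apply: eq_integral => t _.
  by rewrite subKr [in LHS]mulrC.
rewrite -ge0_integralD//; first last.
- by apply: measurable_funTS; mfun.
- by move=> x _; rewrite mule_ge0 ?incbetaI_ge0 ?powR2_ge0.
- by apply: measurable_funTS; mfun.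
- by move=> x _; rewrite mule_ge0 ?incbetaI_ge0 ?powR2_ge0.
rewrite -ge0_itv_integralZl; first last.
- by move=> x; exact: powR2_ge0.
- by mfun.
- exact: betaI_ge0.
apply: eq_integral => t; rewrite inE/= in_itv/= => t01.
by rewrite -ge0_muleDr ?incbetaI_ge0// incbetaI_refl// muleC.
Qed.

End hypergeometric_integrals.

(** * Assembly of the Gamma and 3F2 terms *)

Section rosenblatt5.
Local Open Scope ereal_scope.
Context (R : realType) (d : R).
Hypotheses (d_ge0 : (0 <= d)%R) (d_lt1 : (d < 1)%R).
Let s := (1 - d)%R.
Let s0 : (0 < s)%R. Proof. by rewrite subr_gt0. Qed.
Let ss0 : (0 < s + s)%R. Proof. by rewrite addr_gt0. Qed.

Local Open Scope ring_scope.

Let betaI_s : betaI s s = (Gamma (1 - d) ^+ 2 / Gamma (2 - 2 * d))%:E.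
Proof.
have e : s + s = 2 - 2 * d by rewrite /s; ring.
by rewrite (betaIE s0 s0) e expr2.
Qed.

Let betaI_ss : betaI (s + s) (s + s) =
  (Gamma (2 - 2 * d) ^+ 2 / Gamma (4 - 4 * d))%:E.
Proof.
have e : s + s = 2 - 2 * d by rewrite /s; ring.
have e4 : 2 - 2 * d + (2 - 2 * d) = 4 - 4 * d by ring.
by rewrite (betaIE ss0 ss0) e e4 expr2.
Qed.

Let powtailI_s_s : powtailI d s s =
  (((1 - d) * (2 - 2 * d))^-1
    * hyper3F2 1 d (2 - 2 * d) (2 - d) (3 - 2 * d) 1)%:E.
Proof.
have e1 : s + s = 2 - 2 * d by rewrite /s; ring.
have e2 : s + 1 = 2 - d by rewrite /s; ring.
have e3 : 2 - 2 * d + 1 = 3 - 2 * d by ring.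
by rewrite powtailI_hyper3F2// e1 e2 e3.
Qed.

Let powtailI_ss_s : powtailI d (s + s) s =
  (((1 - d) * (3 - 3 * d))^-1
    * hyper3F2 1 d (3 - 3 * d) (2 - d) (4 - 3 * d) 1)%:E.
Proof.
have e1 : s + s + s = 3 - 3 * d by rewrite /s; ring.
have e2 : s + 1 = 2 - d by rewrite /s; ring.
have e3 : 3 - 3 * d + 1 = 4 - 3 * d by ring.
by rewrite powtailI_hyper3F2// e1 e2 e3.
Qed.

Let powtailI_s_ss : powtailI d s (s + s) =
  (((2 - 2 * d) * (3 - 3 * d))^-1
    * hyper3F2 1 d (3 - 3 * d) (3 - 2 * d) (4 - 3 * d) 1)%:E.
Proof.
have e0 : s + s = 2 - 2 * d by rewrite /s; ring.
have e1 : s + (2 - 2 * d) = 3 - 3 * d by rewrite /s; ring.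
have e2 : 2 - 2 * d + 1 = 3 - 2 * d by ring.
have e3 : 3 - 3 * d + 1 = 4 - 3 * d by ring.
by rewrite powtailI_hyper3F2// e0 e1 e2 e3.
Qed.

Let powincbetaI_ss_s : powincbetaI s d (s + s) s =
  (Gamma (3 - 3 * d) * Gamma (1 - d) / Gamma (4 - 4 * d) / (1 - d)
    * hyper3F2 d (1 - d) (3 - 3 * d) (2 - d) (4 - 4 * d) 1)%:E.
Proof.
have e1 : s + s + s = 3 - 3 * d by rewrite /s; ring.
have e2 : s + 1 = 2 - d by rewrite /s; ring.
have e3 : 3 - 3 * d + s = 4 - 4 * d by rewrite /s; ring.
by rewrite powincbetaI_hyper3F2// e1 e2 e3.
Qed.

Let powincbetaI_s_ss : powincbetaI s d s (s + s) =
  (Gamma (2 - 2 * d) ^+ 2 / Gamma (4 - 4 * d) / (1 - d)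
    * hyper3F2 d (1 - d) (2 - 2 * d) (2 - d) (4 - 4 * d) 1)%:E.
Proof.
have e1 : s + s = 2 - 2 * d by rewrite /s; ring.
have e2 : s + 1 = 2 - d by rewrite /s; ring.
have e3 : 2 - 2 * d + (2 - 2 * d) = 4 - 4 * d by ring.
by rewrite powincbetaI_hyper3F2// e1 e2 e3 expr2.
Qed.

Lemma chain_sum5 :
  (chain d 3 1 0 1 + chain d 1 1 0 1 * chain d 2 1 0 1)%E =
  (Gamma (1 - d) ^+ 4 / Gamma (4 - 4 * d)
   + Gamma (1 - d) ^+ 3 / ((1 - d) * Gamma (2 - 2 * d))
     * (Gamma (3 - 3 * d) / Gamma (4 - 4 * d))
     * hyper3F2 d (1 - d) (3 - 3 * d) (2 - d) (4 - 4 * d) 1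
   + Gamma (1 - d) ^+ 2 * Gamma (2 - 2 * d)
       / ((1 - d) * Gamma (4 - 4 * d))
     * hyper3F2 d (1 - d) (2 - 2 * d) (2 - d) (4 - 4 * d) 1
   + Gamma (1 - d) ^+ 2 / (3 * (1 - d) * Gamma (3 - 2 * d))
     * hyper3F2 1 d (3 - 3 * d) (3 - 2 * d) (4 - 3 * d) 1
   + 2 * Gamma (1 - d) ^+ 2
       / (3 * (1 - d) ^+ 2 * Gamma (2 - 2 * d))
     * hyper3F2 1 d (3 - 3 * d) (2 - d) (4 - 3 * d) 1
   + Gamma (1 - d) ^+ 2 / ((1 - d) * Gamma (3 - 2 * d))
     * hyper3F2 1 d (2 - 2 * d) (2 - d) (3 - 2 * d) 1)%:E.
Proof.
rewrite chain1E chain2E chain3E -/s.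
(* The product [B Beta(s, 2 s)] occurring in [chain 2 1 0 1] is traded for the two integrals that
   carry the second and third terms of [S]. *)
have := powincbetaI_add d (s + s) s.
rewrite -/s powincbetaI_ss_s powincbetaI_s_ss => /esym.
rewrite [betaI (s + s) s]betaIC => J.
rewrite [X in (_ + X)%E](_ : _ = betaI s s * (betaI s s * betaI s (s + s)) +
  betaI s s * powtailI d s s)%E; last first.
  by rewrite ge0_muleDr ?mule_ge0 ?betaI_ge0 ?powtailI_ge0.
rewrite J betaI_s betaI_ss powtailI_s_s powtailI_ss_s powtailI_s_ss.
rewrite !(=^~ EFinM, =^~ EFinD); congr EFin.
have d2 : 0 < 2 - 2 * d by move: ss0; rewrite /s; lra.
have d4 : 0 < 4 - 4 * d by lra.
(* In the fourth and sixth terms [Gamma (3 - 2 * d)] absorbs the factor [2 - 2 d] coming from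
   [powtailI]. *)
have -> : Gamma (3 - 2 * d) = (2 - 2 * d) * Gamma (2 - 2 * d).
  by rewrite -(Gamma_recur d2); congr Gamma; ring.
have G2 := Gamma_gt0 d2; have G4 := Gamma_gt0 d4.
set h1 := hyper3F2 d (1 - d) (3 - 3 * d) _ _ _.
set h2 := hyper3F2 d (1 - d) (2 - 2 * d) _ _ _.
set h3 := hyper3F2 1 d (3 - 3 * d) (3 - 2 * d) _ _.
set h4 := hyper3F2 1 d (3 - 3 * d) (2 - d) _ _.
set h5 := hyper3F2 1 d (2 - 2 * d) _ _ _.
(* With the Gamma and 3F2 values generalized, the claim is a rational identity. *)
move: h1 h2 h3 h4 h5 (Gamma (1 - d)) (Gamma (2 - 2 * d)) (Gamma (3 - 3 * d))
  (Gamma (4 - 4 * d)) G2 G4 => h1 h2 h3 h4 h5 X Y Z W Y0 W0.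
rewrite /s; field.
by repeat (apply/andP; split); apply/eqP; lra.
Qed.

End rosenblatt5.

Theorem mainTheorem2 (R : realType) (d : R) (d_ge0 : 0 <= d)
    (d_le_half : d <= 2^-1) :
  rosenblatt_cumulant d 5 =
  (3840 * (2^-1 * (1 - 2 * d) * (1 - d)) `^ (5 / 2)
    * (Gamma (4 - 5 * d) / Gamma (6 - 5 * d))
    * (Gamma (1 - d) ^+ 4 / Gamma (4 - 4 * d)
       + Gamma (1 - d) ^+ 3 / ((1 - d) * Gamma (2 - 2 * d))
         * (Gamma (3 - 3 * d) / Gamma (4 - 4 * d))
         * hyper3F2 d (1 - d) (3 - 3 * d) (2 - d) (4 - 4 * d) 1
       + Gamma (1 - d) ^+ 2 * Gamma (2 - 2 * d)
           / ((1 - d) * Gamma (4 - 4 * d))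
         * hyper3F2 d (1 - d) (2 - 2 * d) (2 - d) (4 - 4 * d) 1
       + Gamma (1 - d) ^+ 2 / (3 * (1 - d) * Gamma (3 - 2 * d))
         * hyper3F2 1 d (3 - 3 * d) (3 - 2 * d) (4 - 3 * d) 1
       + 2 * Gamma (1 - d) ^+ 2
           / (3 * (1 - d) ^+ 2 * Gamma (2 - 2 * d))
         * hyper3F2 1 d (3 - 3 * d) (2 - d) (4 - 3 * d) 1
       + Gamma (1 - d) ^+ 2 / ((1 - d) * Gamma (3 - 2 * d))
         * hyper3F2 1 d (2 - 2 * d) (2 - d) (3 - 2 * d) 1))%:E.
Proof.
have d1 : d < 1 by lra.
rewrite /rosenblatt_cumulant cyclic_integral5_chain; last by lra.
rewrite chain_sum5// muleA -!EFinM; congr EFin.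
set S := (_ / Gamma (4 - 4 * d) + _ + _ + _ + _ + _).
have d4 : 0 < 4 - 5 * d by lra.
(* The constants then match: [3840 / (5 - 5 d) = 768 / (1 - d)], and 768 is [2^4] times [4!] from
   the cumulant times the 2 from [cyclic_integral5_chain]. *)
have -> : Gamma (6 - 5 * d) = (5 - 5 * d) * ((4 - 5 * d) * Gamma (4 - 5 * d)).
  have d5 : 0 < 5 - 5 * d by lra.
  have e4 : 4 - 5 * d + 1 = 5 - 5 * d by ring.
  have e5 : 5 - 5 * d + 1 = 6 - 5 * d by ring.
  by rewrite -(Gamma_recur d4) e4 -(Gamma_recur d5) e5.
(* This includes [d = 1/2], where both sides are 0. *)
have -> : (2^-1 * (1 - 2 * d) * (1 - d)) `^ (5 / 2) = rosenblatt_sigma d ^+ 5.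
  rewrite /rosenblatt_sigma -powR_mulrn ?powR_ge0// -powRrM.
  by congr (_ `^ _); rewrite mulrC.
have G4 := Gamma_gt0 d4.
rewrite (_ : 5.-1`!%:R = 24 :> R)%R//.
move: S (rosenblatt_sigma d) (Gamma _) G4 => S sg G G4 /=.
field; repeat (apply/andP; split); apply/eqP; lra.
Qed.
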